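(* There exists an absolute constant $c_2>0$ such that for every irreducible, reversible Markov chain on a finite state space with stationary distribution $\pi$ one has both $\Lambda(\delta)\le \kappa(\delta)\le \frac{1}{c_2}\Lambda(\delta)$ for all $\delta\in[\pi_*,1]$, and $$\frac{c_{\mathrm{LS}}}{17}\;\le\;\min_{\delta\in[\pi_*,1/2]}\frac{\kappa(\delta)}{\log(1/\delta)}\;\le\;\frac{c_{\mathrm{LS}}}{c_2}.$$
   Context: State spaces $V$ are assumed to have at least two elements. $(X_m)_{m\ge0}$ is the discrete-time chain with transition matrix $P$, reversible w.r.t. $\pi$. For $D\subseteq V$, $T_{D}:=\inf\{m\ge0:X_m\in D\}$, $D^c:=V\setminus D$, and for nonempty $D$, $\pi_D(x):=\frac{\pi(x)}{\pi(D)}\mathbf 1\{x\in D\}$; $\mathbb{E}_\mu$ is expectation with initial distribution $\mu$. For $\emptyset\ne B\subsetneq V$, $P_B$ is the restriction of $P$ to $B$: $P_B(x,y)=P(x,y)$ for $x,y\in B$. $\beta(B)=1-\lambda(B)$ denotes the largest eigenvalue of $P_B$. $B$ is irreducible if $\sum_{n=0}^\infty (P_B)^n(x,y)>0$ for all $x,y\in B$. Let $\pi_*:=\min_{x\in V}\pi(x)$. The spectral profile is $\Lambda(\delta):=\min\{\lambda(B):B\subset V,\ 0<\pi(B)\le\delta\}$ for $\delta\in[\pi_*,1-\pi_*]$, and $\Lambda(\delta):=\Lambda(1-\pi_* )$ for $\delta>1-\pi_*$. Also $$\kappa(\delta):=\min\left\{\frac{1}{\mathbb{E}_{\pi_B}[T_{B^c}]}: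 B\subset V,\ 0<\pi(B)\le \min\{\delta,1-\pi_*\},\ B\text{ is irreducible}\right\}.$$ $c_{\mathrm{LS}}$ is the log-Sobolev constant of the chain (in the sense of Diaconis and Saloff-Coste): $$c_{\mathrm{LS}}:=\inf\left\{\frac{\langle (I-P)f,f\rangle_\pi}{\mathrm{Ent}_\pi(f^2)}: f\in\mathbb{R}^V \text{ with } \mathrm{Ent}_\pi(f^2)\neq0\right\},$$ where $\langle g,h\rangle_\pi:=\sum_x\pi(x)g(x)h(x)$ and $\mathrm{Ent}_\pi(f^2):=\sum_x\pi(x)f(x)^2\log\left(\frac{f(x)^2}{\sum_y\pi(y)f(y)^2}\right)$ (with $0\log 0=0$). *)

(* Defs.v *)
From HB Require Import structures.
From mathcomp Require Import all_boot all_order all_algebra.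
From mathcomp Require Import all_classical all_reals all_analysis.

Set Implicit Arguments.
Unset Strict Implicit.
Unset Printing Implicit Defensive.
Import Order.TTheory GRing.Theory Num.Theory.
Import numFieldNormedType.Exports.

Local Open Scope classical_set_scope.
Local Open Scope ring_scope.

Section Extrema.
Context {R : realType}.

Definition is_min (A : set R) (m : R) := A m /\ lbound A m.
Definition is_max (A : set R) (m : R) := A m /\ ubound A m.

(* The minimum and maximum are 0 when not attained; every set they are applied
   to below is finite and, in the intended situation, nonempty. *)
Definition minimum (A : set R) : R := xget 0 (is_min A).
Definition maximum (A : set R) : R := xget 0 (is_max A).

End Extrema.

Section Chains.
Context {R : realType} {V : finType}.
Implicit Types (P : V -> V -> R) (pi mu f g h : V -> R) (B D : {set V}).

Definition distribution_on mu := (forall x, 0 <= mu x) /\ \sum_x mu x = 1.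

Definition stochastic P := forall x, distribution_on (P x).

Definition reversible P pi := forall x y, pi x * P x y = pi y * P y x.

(* P_B, with the elements of B numbered by enum_val. *)
Definition restr P B : 'M[R]_#|B| :=
  \matrix_(i, j) P (enum_val i) (enum_val j).

Definition irreducible_on P B := forall i j : 'I_#|B|,
  (0 < \sum_(0 <= n <oo) ((restr P B ^+ n) i j)%:E)%E.

(* Stationarity of pi follows from reversibility. *)
Definition irreducible_reversible P pi :=
  [/\ stochastic P, irreducible_on P [set: V]%SET,
      distribution_on pi & reversible P pi].

Definition mass pi B : R := \sum_(x in B) pi x.

Definition pi_star pi : R := minimum (range pi).

Definition cond pi B : V -> R := fun x => pi x / mass pi B * (x \in B)%:R.

(* Left and right eigenvalues of a matrix are the same. *)
Definition beta P B : R := maximum [set a | eigenvalue (restr P B) a].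
Definition lambda P B : R := 1 - beta P B.

Definition Lambda P pi (delta : R) : R :=
  minimum [set lambda P B | B in
    [set B | 0 < mass pi B <= Num.min delta (1 - pi_star pi)]].

(* X is a Markov chain under Q with transition matrix P and initial
   distribution mu. *)
Definition markov_chain P mu d (Omega : measurableType d)
    (Q : probability Omega R) (X : nat -> Omega -> V) :=
  (forall n x, measurable (X n @^-1` [set x])) /\
  (forall n (x : nat -> V),
    Q [set w | forall i, (i <= n)%N -> X i w = x i] =
    (mu (x 0%N) * \prod_(i < n) P (x i) (x i.+1))%:E).

(* T_D, equal to +oo on the trajectories that avoid D. *)
Definition hitting_time (Omega : Type) (X : nat -> Omega -> V) D (w : Omega)
  : \bar R := ereal_inf [set m%:R%:E | m in [set m | X m w \in D]].

(* Pr mu plays the role of P_mu.  As fine +oo = 0 and 0^-1 = 0, an infinite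
   expectation would contribute the value 1/oo = 0. *)
Definition kappa P pi d (Omega : measurableType d)
    (Pr : (V -> R) -> probability Omega R) (X : nat -> Omega -> V)
    (delta : R) : R :=
  minimum [set (fine (\int[Pr (cond pi B)]_w hitting_time X (~: B) w))^-1
    | B in [set B | 0 < mass pi B <= Num.min delta (1 - pi_star pi) /\
                    irreducible_on P B]].

Definition inner pi g h : R := \sum_x pi x * g x * h x.

Definition dirichlet P pi f : R :=
  inner pi (fun x => f x - \sum_y P x y * f y) f.

(* Here 0 log 0 = 0. *)
Definition Ent pi g : R :=
  \sum_x pi x * g x * ln (g x / \sum_y pi y * g y).

Definition c_LS P pi : R :=
  inf [set dirichlet P pi f / Ent pi (fun x => f x ^+ 2)
    | f in [set f | Ent pi (fun x => f x ^+ 2) != 0]].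

End Chains.

(* Existence of Markov chains: partition [0, 1[ into successive intervals, one
   for each trajectory prefix, of length the probability of that prefix.
   Prefixes are lists with the latest state first. *)
Module ChainExistence.

Definition unit_measure (R : realType) :=
  mrestr (@lebesgue_measure R) (measurable_itv `[0%R, 1%R[).

HB.instance Definition _ (R : realType) := Measure.on (@unit_measure R).

Lemma unit_measure_setT (R : realType) : @unit_measure R setT = 1%:E.
Proof.
by rewrite /unit_measure /mrestr setTI lebesgue_measure_itv /= lte_fin ltr01
  sube0.
Qed.

HB.instance Definition _ (R : realType) :=
  Measure_isProbability.Build _ _ _ (@unit_measure R) (@unit_measure_setT R).

Section Existence.
Context {R : realType} {V : finType}.
Variables (x0 : V) (P : V -> V -> R) (mu : V -> R).
Hypotheses (stP : stochastic P) (dmu : distribution_on mu).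

Let F (f : V -> R) (k : nat) := \sum_(y | (enum_rank y < k)%N) f y.

Let FS f x : F f (enum_rank x).+1 = F f (enum_rank x) + f x.
Proof.
rewrite /F (bigD1 x)//= addrC; congr (_ + _); apply: eq_bigl => y.
by rewrite ltnS ltn_neqAle andbC; congr (_ && _); rewrite (inj_eq val_inj) (inj_eq enum_rank_inj).
Qed.

Let F_mono f (k l : nat) : distribution_on f -> (k <= l)%N -> F f k <= F f l.
Proof.
move=> [f0 _] kl; rewrite /F [leRHS](bigID (fun y => (enum_rank y < k)%N))/=.
rewrite [X in _ <= X + _](eq_bigl (fun y => (enum_rank y < k)%N)).
  by rewrite lerDl sumr_ge0.
by move=> y /=; rewrite andb_idl// => /leq_trans; apply.
Qed.

Let F0 f : F f 0 = 0. Proof. by rewrite /F big1. Qed.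

Let F1 f : distribution_on f -> F f #|V| = 1.
Proof.
by move=> [_ <-]; rewrite /F; apply: eq_bigl => y; rewrite ltn_ord.
Qed.

Let pickF f t : distribution_on f -> 0 <= t < 1 ->
  exists x : V, F f (enum_rank x) <= t < F f (enum_rank x).+1.
Proof.
move=> df /andP[t0 t1].
have ex : exists k, t < F f k by exists #|V|; rewrite F1.
case: (ex_minnP ex) => -[|k] tk kmin; first by move: tk; rewrite F0 ltNge t0.
have kV : (k < #|V|)%N by apply: kmin; rewrite F1.
exists (enum_val (Ordinal kV)); rewrite enum_valK /= tk andbT leNgt.
by apply/negP => /kmin; rewrite ltnn.
Qed.

Let uniqF f t (x y : V) : distribution_on f ->
  F f (enum_rank x) <= t < F f (enum_rank x).+1 ->
  F f (enum_rank y) <= t < F f (enum_rank y).+1 -> x = y.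
Proof.
move=> df /andP[x1 x2] /andP[y1 y2]; apply: enum_rank_inj; apply: val_inj => /=.
case: (ltngtP (enum_rank x) (enum_rank y)) => // h.
- by have := le_lt_trans (le_trans (F_mono df h) y1) x2; rewrite ltxx.
- by have := le_lt_trans (le_trans (F_mono df h) x1) y2; rewrite ltxx.
Qed.

Let trans (s : seq V) := if s is y :: _ then P y else mu.

Let dtrans s : distribution_on (trans s).
Proof. by case: s => [|y s] //=; exact: stP. Qed.

Let Ft s k : 0 <= F (trans s) k.
Proof. by rewrite -(F0 (trans s)); exact: F_mono. Qed.

Let Ft1 s (x : V) : F (trans s) (enum_rank x).+1 <= 1.
Proof. by rewrite -(F1 (dtrans s)); apply: F_mono => //; exact: ltn_ord. Qed.

Fixpoint len (s : seq V) : R :=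
  if s is x :: s' then len s' * trans s' x else 1.

Fixpoint lo (s : seq V) : R :=
  if s is x :: s' then lo s' + len s' * F (trans s') (enum_rank x) else 0.

Let inI s w := lo s <= w < lo s + len s.

Let len_ge0 s : 0 <= len s.
Proof. by elim: s => //= x s ?; apply: mulr_ge0 => //; exact: (dtrans s).1. Qed.

Let inI_cons x s w : inI (x :: s) w = (lo s + len s * F (trans s) (enum_rank x)
  <= w < lo s + len s * F (trans s) (enum_rank x).+1).
Proof. by rewrite /inI /= FS mulrDr addrA. Qed.

Let inI_behead x s w : inI (x :: s) w -> inI s w.
Proof.
rewrite inI_cons /inI => /andP[a b].
have := len_ge0 s; have := Ft s (enum_rank x); have := Ft1 s x => h1 h2 h3.
apply/andP; split.
  by apply: le_trans a; rewrite lerDl mulr_ge0.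
by apply: lt_le_trans b _; rewrite lerD2l ler_piMr.
Qed.

Let inI_pos s w : inI s w -> 0 < len s.
Proof. by rewrite /inI => /andP[a b]; have := le_lt_trans a b; rewrite ltrDl. Qed.

Let inI_scale x s w : 0 < len s ->
  inI (x :: s) w = (F (trans s) (enum_rank x) <= (w - lo s) / len s
     < F (trans s) (enum_rank x).+1).
Proof.
move=> s0; rewrite inI_cons ler_pdivlMr// ltr_pdivrMr//.
by rewrite lerBrDr ltrBlDr ![_ * len s]mulrC ![_ + lo s]addrC.
Qed.

Let inI_ex s w : inI s w -> exists x, inI (x :: s) w.
Proof.
move=> h; have s0 := inI_pos h.
have [|x hx] := @pickF (trans s) ((w - lo s) / len s) (dtrans s).
  move: h; rewrite /inI => /andP[a b].
  by rewrite divr_ge0 ?subr_ge0//= ltr_pdivrMr// mul1r ltrBlDl.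
by exists x; rewrite inI_scale.
Qed.

Let inI_uniq x y s w : inI (x :: s) w -> inI (y :: s) w -> x = y.
Proof.
move=> hx hy; have s0 := inI_pos (inI_behead hx).
by move: hx hy; rewrite !inI_scale//; exact: uniqF.
Qed.

Fixpoint traj w n : seq V := if n is k.+1 then
    odflt x0 [pick x | inI (x :: traj w k) w] :: traj w k
  else [::].

Let size_traj w n : size (traj w n) = n.
Proof. by elim: n => //= n ->. Qed.

Let traj_in w n : 0 <= w < 1 -> inI (traj w n) w.
Proof.
move=> w01; elim: n => [|n ih]; first by rewrite /inI /= add0r.
rewrite [traj _ _]/=; case: pickP => //= h.
by have [x] := inI_ex ih; rewrite h.
Qed.

Let inI_traj s w : inI s w -> traj w (size s) = s.
Proof.
elim: s => //= x s ih h; rewrite ih; last exact: inI_behead h.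
case: pickP => [y hy|/(_ x)]; last by rewrite h.
by rewrite (inI_uniq hy h).
Qed.

Let inI_unit s w : inI s w -> 0 <= w < 1.
Proof.
elim: s => [|x s ih] h; first by move: h; rewrite /inI /= add0r.
exact: ih (inI_behead h).
Qed.

Let traj_out w n : ~~ (0 <= w < 1) -> traj w n = nseq n x0.
Proof.
move=> w01; elim: n => //= n ->; congr (_ :: _).
by case: pickP => //= x /inI_unit; rewrite (negbTE w01).
Qed.

Let trajI s : [set w | traj w (size s) = s] `&` [set` `[0, 1[] =
  [set` `[lo s, lo s + len s[].
Proof.
apply/seteqP; split => w /=; rewrite !in_itv /=.
  by move=> [<-] w01; exact: traj_in.
by move=> h; split; [exact: inI_traj | exact: inI_unit h].
Qed.

Let traj_meas n s : measurable [set w | traj w n = s].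
Proof.
have [<-|ns] := eqVneq (size s) n; last first.
  rewrite (_ : [set w | _] = set0)//; apply/seteqP; split => //= w h.
  by move: ns; rewrite -h size_traj eqxx.
rewrite -[X in measurable X](setUIDK _ [set` `[(0:R), 1[]) trajI.
apply: measurableU => //.
have [e|e] := eqVneq s (nseq (size s) x0).
  rewrite (_ : _ `\` _ = ~` [set` `[(0:R), 1[]); first exact: measurableC.
  apply/seteqP; split => w /=; rewrite in_itv /=; first by case.
  by move=> h; split => //; rewrite traj_out//; exact/negP.
rewrite (_ : _ `\` _ = set0)//; apply/seteqP; split => // w [/= h].
by rewrite in_itv /= => /negP h'; move: e; rewrite -{1}h traj_out// eqxx.
Qed.

Definition coord n w := head x0 (traj w n.+1).

Let revpath (x : nat -> V) n := rev (mkseq x n).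

Let revpathS x n : revpath x n.+1 = x n :: revpath x n.
Proof. by rewrite /revpath mkseqS rev_rcons. Qed.

Let coord_traj x n w :
  (forall i, (i <= n)%N -> coord i w = x i) <-> traj w n.+1 = revpath x n.+1.
Proof.
elim: n => [|n ih].
  rewrite revpathS /coord; split => [/(_ 0%N isT) <- //|h i].
  by rewrite leqn0 => /eqP ->; rewrite h.
have E : traj w n.+2 = coord n.+1 w :: traj w n.+1 by [].
rewrite E revpathS; split => [h|[h1 h2] i].
  by congr (_ :: _); [exact: h|apply/ih => i /leqW; exact: h].
by rewrite leq_eqVlt => /orP[/eqP -> //|]; rewrite ltnS; exact: (ih.2 h2).
Qed.

Let len_revpath x n : len (revpath x n.+1) =
  mu (x 0%N) * \prod_(i < n) P (x i) (x i.+1).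
Proof.
elim: n => [|n ih]; first by rewrite revpathS /revpath /= big_ord0 mul1r mulr1.
by rewrite revpathS /= ih {1}revpathS /= big_ord_recr /= mulrA.
Qed.

Lemma coord_chain : markov_chain P mu (@unit_measure R) coord.
Proof.
split=> [n x|n x].
  rewrite (_ : _ @^-1` _ = \bigcup_(s in [set: n.-tuple V])
      [set w | traj w n.+1 = x :: s]).
    by apply: fin_bigcup_measurable => // s _; exact: traj_meas.
  apply/seteqP; split => w /=.
    move=> <-; have sz : size (traj w n) == n by rewrite size_traj.
    by exists (Tuple sz).
  by case=> s _ /= ; rewrite /coord /= => -[].
rewrite (_ : [set w | _] = [set w | traj w n.+1 = revpath x n.+1]); last first.
  by apply/seteqP; split => w /= /coord_traj.
have sz : n.+1 = size (revpath x n.+1) by rewrite /revpath size_rev size_mkseq.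
rewrite /unit_measure /mrestr.
have tE := trajI (revpath x n.+1); rewrite -sz in tE.
rewrite [LHS](congr1 (@lebesgue_measure R) tE).
rewrite lebesgue_measure_itv /= lte_fin.
rewrite -len_revpath ltrDl -EFinD addrAC subrr add0r.
case: ltP => // h; congr (_%:E); apply/eqP.
by rewrite eq_le h len_ge0.
Qed.

End Existence.

(* Some measurable space carries a process that is a Markov chain with matrix P
   from every initial distribution: V^nat with the cylinder sigma-algebra. *)
Lemma markov_chain_exists (R : realType) (V : finType) (P : V -> V -> R) :
  (0 < #|V|)%N -> stochastic P ->
  exists d (Omega : measurableType d) (Pr : (V -> R) -> probability Omega R)
    (X : nat -> Omega -> V),
  forall mu, distribution_on mu -> markov_chain P mu (Pr mu) X.
Proof.
move=> /card_gt0P[x0 _] stP.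
pose Vp : pointedType := HB.pack V (isPointed.Build V x0).
pose G : set (set (nat -> Vp)) :=
  [set [set w : nat -> Vp | w nx.1 = nx.2] | nx in [set: nat * Vp]].
pose Om := g_sigma_algebraType G.
have coordm n (x : V) : measurable ([set w | w n = x] : set Om).
  by apply: sub_gen_smallest; exists (n, x).
suff /choice[Pr h] : forall mu : V -> R, exists Q : probability Om R,
    distribution_on mu -> markov_chain P mu Q (fun n (w : Om) => w n : V).
  by exists _, Om, Pr, (fun n (w : Om) => w n : V).
move=> mu; have [dmu|] := pselect (distribution_on mu); last first.
  by move=> nd; exists point.
have [Xm XP] := coord_chain x0 stP dmu.
pose Phi (w : measurableTypeR R) : Om := fun n => coord x0 P mu n w.
have mPhi : measurable_fun setT Phi.
  apply: (@measurability _ _ _ Om setT Phi G) => // _ [_ [[n x] _ <-] <-].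
  by rewrite setTI; exact: Xm.
pose PhiM : {mfun measurableTypeR R >-> Om} :=
  HB.pack Phi (isMeasurableFun.Build _ _ _ _ Phi mPhi).
exists (distribution (@unit_measure R) PhiM) => _.
by split => [n x|n x]; [exact: coordm | exact: XP].
Qed.

End ChainExistence.

(* Main.v *)
(** For a proper subset [A], the mean exit time [tau] from the stationary law of
    [A] is governed by the solution [h] of [(I - P) h = 1] on [A], [h = 0] off
    [A]: by Cauchy-Schwarz for the Dirichlet form [E], every [g] supported in [A]
    satisfies [(\sum pi g)^2 <= pi(A) tau E(g)], with equality for [g = h].
    Comparing with the Rayleigh quotient of [h] gives [Lambda <= kappa], and
    testing the log-Sobolev inequality on [h] bounds [c_LS] from above.

    Conversely, let [u >= 0] be cut into the dyadic slices of its level sets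
    [A_j = {u > t_j}], [t_j = e 2^j]. The slices have total energy at most [E(u)],
    and each slice exceeds [t_j] on [A_(j+1)], so the capacity inequality on [A_j]
    shows that the weight [t_j^2 pi(A_j) phi(pi(A_j))] either drops by a constant
    factor from [j] to [j+1] or is paid for by the energy of the slice. Summing
    over [j] bounds [\sum pi u^2 phi] by a multiple of [E(u)]. With [phi] constant and [u] the
    modulus of the leading eigenfunction this is [kappa <= C Lambda]; with
    [phi(p) = m ln(1/p)], applied to both sides of the median of [|f|], it is the
    log-Sobolev inequality. *)

Require Import Defs.
From mathcomp Require Import all_boot all_order all_algebra.
From mathcomp Require Import all_classical all_reals all_analysis.
From mathcomp Require Import ring lra.

Set Implicit Arguments.
Unset Strict Implicit.
Unset Printing Implicit Defensive.
Import Order.TTheory GRing.Theory Num.Theory.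
Import numFieldNormedType.Exports.

Local Open Scope classical_set_scope.
Local Open Scope ring_scope.

(** * The Dirichlet form *)

(** Besides Cauchy-Schwarz, this yields first-order optimality conditions: with [a = 0] it forces
    [b = 0]. *)
Lemma discriminant_le (R : realFieldType) (a b c : R) : 0 <= c ->
  (forall t, 0 <= a + 2 * b * t + c * t ^+ 2) -> b ^+ 2 <= a * c.
Proof.
rewrite le_eqVlt => /orP[/eqP<-|c0] h.
- rewrite mulr0; have [->|b0] := eqVneq b 0; first by rewrite expr0n.
  (* Without quadratic term the polynomial is affine, and at this argument it takes the value
     [-1]. *)
  have := h (- (a + 1) / (2 * b)); rewrite mul0r addr0.
  have -> : 2 * b * (- (a + 1) / (2 * b)) = - (a + 1) by field.
  lra.
- have := h (- b / c).
  have -> : a + 2 * b * (- b / c) + c * (- b / c) ^+ 2 = (a * c - b ^+ 2) / c.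
    by field; rewrite gt_eqF.
  by rewrite pmulr_lge0 ?invr_gt0// subr_ge0.
Qed.

Section Dirichlet.
Context {R : realType} {V : finType}.
Variables (P : V -> V -> R) (pi : V -> R).
Implicit Types (f g h : V -> R) (A B : {set V}).

Definition energy f g : R :=
  2^-1 * \sum_x \sum_y pi x * P x y * ((f x - f y) * (g x - g y)).

Lemma energyC f g : energy f g = energy g f.
Proof.
rewrite /energy; congr (_ * _); apply: eq_bigr => x _.
by apply: eq_bigr => y _; rewrite [_ * (g x - g y)]mulrC.
Qed.

Lemma energyDr f g h : energy f (fun x => g x + h x) = energy f g + energy f h.
Proof.
rewrite /energy -mulrDr -big_split; congr (_ * _); apply: eq_bigr => x _ /=.
rewrite -big_split; apply: eq_bigr => y _ /=; ring.
Qed.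

Lemma energyZr f g a : energy f (fun x => a * g x) = a * energy f g.
Proof.
rewrite /energy [RHS]mulrCA; congr (_ * _); rewrite mulr_sumr; apply: eq_bigr => x _ /=.
rewrite mulr_sumr; apply: eq_bigr => y _ /=; ring.
Qed.

Hypotheses (stP : stochastic P) (revP : reversible P pi).

(** Summation by parts: reversibility makes the weights [pi x * P x y] symmetric, so exchanging [x]
    and [y] turns the factor [g x] into [- g y]. *)
Lemma inner_laplacian f g :
  inner pi (fun x => f x - \sum_y P x y * f y) g = energy f g.
Proof.
set S := \sum_x \sum_y pi x * P x y * ((f x - f y) * g x).
have -> : inner pi (fun x => f x - \sum_y P x y * f y) g = S.
  apply: eq_bigr => x _; have [_ P1] := stP x.
  rewrite -[f x in LHS]mul1r -P1 mulr_suml -sumrB mulr_sumr mulr_suml.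
  by apply: eq_bigr => y _; ring.
suff : \sum_x \sum_y pi x * P x y * ((f x - f y) * (g x - g y)) = S + S.
  by rewrite /energy => ->; field.
have -> : S + S = S - \sum_x \sum_y pi x * P x y * ((f x - f y) * g y).
  congr (_ + _); rewrite exchange_big /= -sumrN; apply: eq_bigr => x _.
  rewrite -sumrN; apply: eq_bigr => y _; rewrite revP; ring.
rewrite -sumrB; apply: eq_bigr => x _; rewrite -sumrB; apply: eq_bigr => y _.
ring.
Qed.

Lemma dirichlet_energy f : dirichlet P pi f = energy f f.
Proof. exact: inner_laplacian. Qed.

Hypothesis pi_gt0 : forall x, 0 < pi x.

Let w_ge0 x y : 0 <= pi x * P x y.
Proof. by have [h _] := stP x; rewrite mulr_ge0 ?h ?(ltW (pi_gt0 x)). Qed.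

Lemma ler_energy f g :
  (forall x y, (f x - f y) ^+ 2 <= (g x - g y) ^+ 2) ->
  energy f f <= energy g g.
Proof.
move=> h; rewrite ler_wpM2l// ?invr_ge0//; apply: ler_sum => x _.
by apply: ler_sum => y _; rewrite -!expr2 ler_wpM2l.
Qed.

Lemma ler_sum_energy n (f : 'I_n -> V -> R) g :
  (forall x y, \sum_i (f i x - f i y) ^+ 2 <= (g x - g y) ^+ 2) ->
  \sum_i energy (f i) (f i) <= energy g g.
Proof.
move=> h; rewrite -mulr_sumr ler_wpM2l// ?invr_ge0//.
rewrite exchange_big; apply: ler_sum => x _.
rewrite exchange_big; apply: ler_sum => y _ /=.
by rewrite -mulr_sumr ler_wpM2l// -expr2; under eq_bigr do rewrite -expr2.
Qed.

Lemma energy_ge0 f : 0 <= energy f f.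
Proof.
rewrite mulr_ge0// ?invr_ge0// sumr_ge0// => x _; rewrite sumr_ge0// => y _.
by rewrite mulr_ge0// -expr2 sqr_ge0.
Qed.

Lemma energy_cauchy_schwarz f g :
  energy f g ^+ 2 <= energy f f * energy g g.
Proof.
apply: discriminant_le => [|t]; first exact: energy_ge0.
have := energy_ge0 (fun x => f x + t * g x).
rewrite energyDr energyZr !(energyC (fun x => f x + _)) !energyDr !energyZr.
rewrite (energyC g f); lra.
Qed.

Lemma energy0_eq f x y : energy f f = 0 -> 0 < P x y -> f x = f y.
Proof.
move=> /eqP; rewrite mulf_eq0 invr_eq0 pnatr_eq0 /= => E0 Pxy.
move: E0; rewrite psumr_eq0 => [|i _]; last first.
  by rewrite sumr_ge0// => j _; rewrite mulr_ge0// -expr2 sqr_ge0.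
move=> /allP/(_ x); rewrite mem_index_enum => /(_ isT) /=.
rewrite psumr_eq0 => [|j _]; last by rewrite mulr_ge0// -expr2 sqr_ge0.
move=> /allP/(_ y); rewrite mem_index_enum => /(_ isT) /=.
by rewrite !mulf_eq0 (gt_eqF (pi_gt0 x)) (gt_eqF Pxy) /= orbb subr_eq0 => /eqP.
Qed.

Lemma energy_abs f :
  energy (fun x => `|f x|) (fun x => `|f x|) <= energy f f.
Proof.
apply: ler_energy => x y.
by rewrite -[leRHS]real_normK ?num_real// -[leLHS]real_normK ?num_real//
  lerXn2r ?nnegrE// ler_dist_dist.
Qed.

End Dirichlet.

(** * Irreducible sets *)

Section Irreducibility.
Context {R : realType} {V : finType}.
Variables (P : V -> V -> R).
Hypothesis P_ge0 : forall x y, 0 <= P x y.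
Implicit Types (A B S : {set V}).

Definition closed_in B S := forall x y, x \in S -> y \in B -> 0 < P x y -> y \in S.

Lemma restr_exp_ge0 B n i j : 0 <= (restr P B ^+ n) i j.
Proof.
elim: n j => [|n IHn] j; first by rewrite expr0 mxE; case: eqP.
by rewrite exprSr mxE sumr_ge0// => k _; rewrite mulr_ge0// mxE.
Qed.

(** Paths inside [B] that start in [S] stay in [S], so every power of the restricted matrix vanishes
    from [S] to a state of [B] outside [S]. *)
Lemma irreducible_closed B S : irreducible_on P B -> S \subset B ->
  S != finset.set0 -> closed_in B S -> S = B.
Proof.
move=> irB /fintype.subsetP SB /set0Pn[x xS] clS; apply/eqP; rewrite finset.eqEsubset.
apply/andP; split; first exact/fintype.subsetP.
apply/fintype.subsetP => y yB; rewrite -[_ \in _]negbK; apply/negP => yS.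
pose i := enum_rank_in (SB x xS) x; pose j := enum_rank_in (SB x xS) y.
have iE : enum_val i = x by rewrite enum_rankK_in// SB.
have jE : enum_val j = y by rewrite enum_rankK_in.
have h n : forall k, enum_val k \notin S -> (restr P B ^+ n) i k = 0.
  elim: n => [|n IHn] k kS.
    by rewrite expr0 mxE; case: eqP => // ik; move: kS; rewrite -ik iE xS.
  rewrite exprSr mxE big1// => l _.
  have [lS|lS] := boolP (enum_val l \in S); last by rewrite IHn// mul0r.
  rewrite [X in _ * X]mxE.
  have [Plk|] := ltP 0 (P (enum_val l) (enum_val k)).
    by move: kS; rewrite (clS _ _ lS (enum_valP k) Plk).
  move=> Plk; have /eqP -> : P (enum_val l) (enum_val k) == 0.
    by rewrite eq_le Plk P_ge0.
  by rewrite mulr0.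
have := irB i j; rewrite (eq_eseriesr (g := fun=> 0%E)); last first.
  by move=> n _; rewrite h// jE.
by rewrite eseries0 ?ltxx.
Qed.

(** The set of states of [B] reachable from [i] is closed, hence all of [B]. *)
Lemma closed_irreducible B :
  (forall S, S \subset B -> S != finset.set0 -> closed_in B S -> S = B) ->
  irreducible_on P B.
Proof.
move=> h i j.
pose S : {set V} := [set y in B | `[< exists2 k, enum_val k = y &
  exists n, 0 < (restr P B ^+ n) i k >]]%SET.
have SE : S = B.
  apply: h; first by apply/fintype.subsetP => y; rewrite inE => /andP[].
    apply/set0Pn; exists (enum_val i); rewrite inE enum_valP; apply/asboolP.
    by exists i => //; exists 0; rewrite expr0 mxE eqxx.
  move=> x y; rewrite !inE => /andP[xB /asboolP[k kx [n nk]]] yB Pxy.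
  rewrite yB; apply/asboolP; pose l := enum_rank_in yB y.
  have lE : enum_val l = y by rewrite enum_rankK_in.
  exists l => //; exists n.+1; rewrite exprSr mxE (bigD1 k)//=.
  rewrite ltr_wpDr ?sumr_ge0// => [m _|].
    by rewrite mulr_ge0 ?restr_exp_ge0// mxE.
  by rewrite mulr_gt0// mxE kx lE.
have : enum_val j \in S by rewrite SE enum_valP.
rewrite inE => /andP[_ /asboolP[k /enum_val_inj -> [n nj]]].
apply: (@lt_le_trans _ _ ((restr P B ^+ n) i j)%:E); first by rewrite lte_fin.
apply: le_trans (nneseries_lim_ge n.+1 _) => [|m _ _]; last first.
  by rewrite lee_fin restr_exp_ge0.
rewrite big_nat_recr//= leeDr// sume_ge0// => m _.
by rewrite lee_fin restr_exp_ge0.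
Qed.

End Irreducibility.

(** * Exit functions and capacity *)

Section ExitFunction.
Context {R : realType} {V : finType}.
Variables (P : V -> V -> R) (pi : V -> R).
Hypothesis chain : irreducible_reversible P pi.
Implicit Types (f g h : V -> R) (A B S : {set V}).

Let stP : stochastic P. Proof. by case: chain. Qed.
Let revP : reversible P pi. Proof. by case: chain. Qed.

Lemma trans_ge0 x y : 0 <= P x y. Proof. by have [] := stP x. Qed.

(** The support of [pi] is closed: a step from a charged to an uncharged state would carry positive
    flow one way and none back. *)
Lemma stationary_gt0 x : 0 < pi x.
Proof.
have [_ irP [pi0 pi1] _] := chain.
pose S : {set V} := [set y | 0 < pi y]%SET.
have SE : S = [set: V]%SET.
  apply: (irreducible_closed trans_ge0 irP).
  - exact: finset.subsetT.
  - apply/set0Pn; have [[y y0]|] := pselect (exists y, 0 < pi y).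
      by exists y; rewrite inE.
    move=> /forallNP nex; have : \sum_x pi x = 0.
      apply: big1 => y _; apply/eqP; rewrite eq_le pi0 andbT leNgt.
      exact/negP/nex.
    by rewrite pi1 => /eqP; rewrite oner_eq0.
  - move=> y z; rewrite !inE => y0 _ Pyz.
    rewrite lt_neqAle pi0 andbT; apply/negP => /eqP z0.
    by have := mulr_gt0 y0 Pyz; rewrite revP -z0 mul0r ltxx.
have : x \in S by rewrite SE inE.
by rewrite inE.
Qed.

Let pi_ge0 x : 0 <= pi x. Proof. exact/ltW/stationary_gt0. Qed.

Lemma mass_ge0 A : 0 <= mass pi A. Proof. exact: sumr_ge0. Qed.

Lemma mass_gt0 A : (0 < mass pi A) = (A != finset.set0).
Proof.
apply/idP/idP => [|/set0Pn[x xA]].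
  by apply: contraTneq => ->; rewrite /mass big_set0 ltxx.
rewrite /mass (bigD1 x)//= ltr_wpDr ?stationary_gt0// sumr_ge0//.
Qed.

Lemma mass_le A B : A \subset B -> mass pi A <= mass pi B.
Proof.
move=> /fintype.subsetP AB.
rewrite /mass big_mkcond [leRHS]big_mkcond /=; apply: ler_sum => x _.
by case: ifPn => [/AB ->//|_]; case: ifP.
Qed.

Lemma mass_setT : mass pi [set: V]%SET = 1.
Proof.
by have [_ _ [_ <-] _] := chain; apply: eq_bigl => x; rewrite inE.
Qed.

Lemma mass_setC A : mass pi A + mass pi (~: A)%SET = 1.
Proof.
rewrite -mass_setT /mass [RHS](bigID (mem A) (mem [set: V]%SET))/=.
by congr (_ + _); apply: eq_bigl => x; rewrite !inE.
Qed.

Lemma mass_lt1 A : (mass pi A < 1) = (A != [set: V]%SET).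
Proof.
apply/idP/idP; first by apply: contraTneq => ->; rewrite mass_setT ltxx.
move=> AT; have : 0 < mass pi (~: A)%SET.
  by rewrite mass_gt0; apply: contra_neq AT => /(congr1 (@finset.setC V));
    rewrite finset.setCK finset.setC0.
by have := mass_setC A; lra.
Qed.

Lemma energy0_cst f x y : energy P pi f f = 0 -> f x = f y.
Proof.
move=> f0; pose S : {set V} := [set z | f z == f x]%SET.
suff SE : S = [set: V]%SET.
  have : y \in S by rewrite SE inE.
  by rewrite inE => /eqP.
have [_ irP _ _] := chain; apply: (irreducible_closed trans_ge0 irP).
- exact: finset.subsetT.
- by apply/set0Pn; exists x; rewrite inE.
- move=> z t; rewrite !inE => /eqP <- _ Pzt.
  by rewrite (energy0_eq stP stationary_gt0 f0 Pzt).
Qed.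

Definition supported f A := forall x, x \notin A -> f x = 0.

(* On [A] this is the first-step equation satisfied by [h x = E_x T_{A^c}]. *)
Definition is_exit A h := supported h A /\
  forall x, x \in A -> h x - \sum_y P x y * h y = 1.

(** A square linear system. A homogeneous solution has zero energy, hence is constant, and it
    vanishes at a state [z] outside [A]. *)
Lemma exit_exists A : A != [set: V]%SET -> exists h, is_exit A h.
Proof.
move=> AT.
have /set0Pn[z zA] : (~: A)%SET != finset.set0.
  by apply: contra_neq AT => /(congr1 (@finset.setC V));
    rewrite finset.setCK finset.setC0.
rewrite inE in zA.
(* Unknowns are row vectors, so column [i] carries the equation at state [i]: the first-step
   operator on [A], the identity off [A]. *)
pose M : 'M[R]_#|V| := \matrix_(j, i)
  ((i == j)%:R - (enum_val i \in A)%:R * P (enum_val i) (enum_val j)).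
have vM (v : 'rV[R]_#|V|) i : (v *m M) 0 i = v 0 i -
    (enum_val i \in A)%:R * \sum_y P (enum_val i) y * v 0 (enum_rank y).
  rewrite mxE; under eq_bigr do rewrite mxE mulrBr.
  rewrite sumrB; congr (_ - _).
    rewrite (bigD1 i)//= eqxx mulr1 big1 ?addr0// => j ji.
    by rewrite eq_sym (negbTE ji) mulr0.
  rewrite mulr_sumr (reindex_onto enum_rank enum_val) => [|j _]; last first.
    exact: enum_valK.
  apply: eq_big => [y|y _]; first by rewrite enum_rankK eqxx.
  by rewrite enum_rankK; ring.
have Mfree : row_free M.
  apply: inj_row_free => v v0.
  pose u x := v 0 (enum_rank x).
  have uE x : u x = (x \in A)%:R * \sum_y P x y * u y.
    apply/eqP; rewrite -subr_eq0; have := vM v (enum_rank x).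
    by rewrite v0 mxE enum_rankK => <-.
  have Eu : energy P pi u u = 0.
    rewrite -inner_laplacian//; apply: big1 => x _; rewrite uE.
    by case: (x \in A); rewrite !(mul1r, mul0r) ?subrr ?mulr0 ?mul0r.
  apply/rowP => i; rewrite mxE -(enum_valK i) -/(u _) (energy0_cst _ z Eu) uE.
  by rewrite (negbTE zA) mul0r.
pose b : 'rV[R]_#|V| := \row_i (enum_val i \in A)%:R.
pose v := b *m invmx M.
have vb : v *m M = b by rewrite mulmxKV// -row_free_unit.
pose h x := v 0 (enum_rank x).
have hE x : h x - (x \in A)%:R * (\sum_y P x y * h y) = (x \in A)%:R.
  by have := vM v (enum_rank x); rewrite vb mxE enum_rankK => <-.
exists h; split => x xA; have := hE x; rewrite ?xA ?(negbTE xA).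
  by rewrite mul0r subr0.
by rewrite mul1r.
Qed.

Definition exit_fun A : V -> R := xget (fun=> 0) (is_exit A).

Lemma exit_funP A : A != [set: V]%SET -> is_exit A (exit_fun A).
Proof. by move=> /exit_exists[h hA]; exact: (xgetI _ hA). Qed.

(** Exit functions are Riesz representatives, for the energy, of the functional [\sum_x pi x * g x]
    on functions supported in [A]. *)
Lemma is_exit_energy A h g : is_exit A h -> supported g A ->
  energy P pi h g = \sum_x pi x * g x.
Proof.
move=> [_ h1] gA; rewrite -inner_laplacian//; apply: eq_bigr => x _.
by have [/h1 ->|/gA ->] := boolP (x \in A); rewrite ?mulr1 ?mulr0.
Qed.

Lemma capacity A h g : is_exit A h -> supported g A ->
  (\sum_x pi x * g x) ^+ 2 <= (\sum_x pi x * h x) * energy P pi g g.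
Proof.
move=> hA gA; rewrite -(is_exit_energy hA gA) -(is_exit_energy hA hA.1).
exact: energy_cauchy_schwarz stationary_gt0 _ _.
Qed.

Lemma sum_exit_ge0 A h : is_exit A h -> 0 <= \sum_x pi x * h x.
Proof.
move=> hA; rewrite -(is_exit_energy hA hA.1).
exact: energy_ge0 stationary_gt0 _.
Qed.

(* Passing to [`|h|] does not increase the energy, so the capacity inequality
   forces [\sum_x pi x * `|h x| <= \sum_x pi x * h x]. *)
Lemma is_exit_ge0 A h x : is_exit A h -> 0 <= h x.
Proof.
move=> hA; pose g x := `|h x|.
have gA : supported g A by move=> y /hA.1; rewrite /g => ->; rewrite normr0.
have gh : energy P pi g g <= energy P pi h h.
  exact: (energy_abs stP stationary_gt0).
have hg y : h y <= g y by exact: ler_norm.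
have sgh : \sum_y pi y * g y <= \sum_y pi y * h y.
  have s0 := sum_exit_ge0 hA.
  have := capacity hA gA; rewrite (is_exit_energy hA hA.1) in gh => c.
  have g0 : 0 <= \sum_x pi x * g x.
    by rewrite sumr_ge0// => y _; rewrite mulr_ge0 ?normr_ge0.
  rewrite -(ler_pXn2r (n := 2)) ?nnegrE//.
  by apply: (le_trans c); rewrite expr2 ler_wpM2l.
have : \sum_y pi y * (g y - h y) = 0.
  apply/eqP; rewrite eq_le sumr_ge0 ?andbT; last first.
    by move=> y _; rewrite mulr_ge0// subr_ge0.
  by under eq_bigr do rewrite mulrBr; rewrite sumrB subr_le0.
move=> /eqP; rewrite psumr_eq0; last first.
  by move=> y _; rewrite mulr_ge0// subr_ge0.
move=> /allP/(_ x); rewrite mem_index_enum => /(_ isT) /=.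
rewrite mulf_eq0 (gt_eqF (stationary_gt0 x)) /= subr_eq0 => /eqP <-.
exact: normr_ge0.
Qed.

Lemma sum_exit_gt0 A h : A != finset.set0 -> is_exit A h ->
  0 < \sum_x pi x * h x.
Proof.
move=> A0 hA; rewrite lt_neqAle (sum_exit_ge0 hA) andbT; apply/negP => /eqP s0.
pose g x : R := (x \in A)%:R.
have gA : supported g A by move=> x; rewrite /g => /negbTE ->.
have := capacity hA gA; rewrite -s0 mul0r.
have -> : \sum_x pi x * g x = mass pi A.
  rewrite /mass [RHS]big_mkcond; apply: eq_bigr => x _.
  by rewrite /g; case: (x \in A); rewrite ?mulr1 ?mulr0.
by rewrite leNgt exprn_gt0// mass_gt0.
Qed.

(** By [mean_hitting_time_cond] this is the mean of [T_{A^c}] under [pi_A]. *)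
Definition mean_exit A : R := (\sum_x pi x * exit_fun A x) / mass pi A.

Lemma mean_exit_gt0 A : A != finset.set0 -> A != [set: V]%SET ->
  0 < mean_exit A.
Proof.
by move=> A0 AT; rewrite divr_gt0 ?mass_gt0// (sum_exit_gt0 A0)//; exact: exit_funP.
Qed.

Lemma mean_exit_capacity A g : A != finset.set0 -> A != [set: V]%SET ->
  supported g A ->
  (mean_exit A)^-1 * (\sum_x pi x * g x) ^+ 2 <= mass pi A * energy P pi g g.
Proof.
move=> A0 AT gA; rewrite mulrC ler_pdivrMr ?mean_exit_gt0//.
rewrite mulrAC /mean_exit [mass pi A * _]mulrC mulfVK ?gt_eqF ?mass_gt0//.
exact: capacity (exit_funP AT) gA.
Qed.

(** By reversibility there are no steps from [A :\: S] into [S] either, so the exit function of [A],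
    cut to either piece, is an exit function there. *)
Lemma exit_split A S : A != [set: V]%SET -> S \subset A -> closed_in P A S ->
  \sum_x pi x * exit_fun A x <=
  \sum_x pi x * exit_fun S x + \sum_x pi x * exit_fun (A :\: S)%SET x.
Proof.
move=> AT /fintype.subsetP SA clS.
have zero x y : x \in S -> y \in (A :\: S)%SET -> P x y = 0.
  move=> xS; rewrite inE => /andP[yS yA]; apply/eqP.
  rewrite eq_le trans_ge0 andbT leNgt.
  by apply: contra yS => /(clS _ _ xS yA).
have zero' x y : x \in S -> y \in (A :\: S)%SET -> P y x = 0.
  move=> xS yA; have := revP x y; rewrite (zero _ _ xS yA) mulr0.
  by move=> /esym/eqP; rewrite mulf_eq0 (gt_eqF (stationary_gt0 y)) => /eqP.
have sub (D : {set V}) : D \subset A -> (forall x y, x \in D -> y \in A -> y \notin D ->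
    P x y = 0) -> \sum_x pi x * ((x \in D)%:R * exit_fun A x) <=
    \sum_x pi x * exit_fun D x.
  move=> /fintype.subsetP DA DC.
  have DT : D != [set: V]%SET.
    apply: contra_neq AT => DE; apply/setP => x; rewrite inE.
    by apply: DA; rewrite DE inE.
  have [sA eA] := exit_funP AT.
  pose g x := (x \in D)%:R * exit_fun A x.
  have gD : supported g D by move=> x /negbTE; rewrite /g => ->; rewrite mul0r.
  have gE : is_exit D g.
    split => // x xD; rewrite -(eA _ (DA _ xD)) /g xD mul1r; congr (_ - _).
    apply: eq_bigr => y _; have [|yD] := boolP (y \in D); first by rewrite mul1r.
    rewrite mul0r mulr0; have [yA|/sA ->] := boolP (y \in A); last first.
      by rewrite mulr0.
    by rewrite (DC _ _ xD yA yD) mul0r.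
  (* In place of uniqueness of exit functions: capacity gives [s ^ 2 <= s' * s], with [s] and [s']
     the sums for [g] and [exit_fun D]. *)
  have := capacity (exit_funP DT) gD.
  rewrite (is_exit_energy gE gD) expr2.
  have := sum_exit_ge0 gE; rewrite -/(g _) le_eqVlt => /orP[/eqP <- _|s0].
    exact: sum_exit_ge0 (exit_funP DT).
  by rewrite ler_pM2r.
have -> : \sum_x pi x * exit_fun A x =
    \sum_x pi x * ((x \in S)%:R * exit_fun A x) +
    \sum_x pi x * ((x \in (A :\: S)%SET)%:R * exit_fun A x).
  rewrite -big_split /=; apply: eq_bigr => x _; rewrite !inE.
  have [xA|xA] := boolP (x \in A); last by rewrite (exit_funP AT).1// !mulr0 addr0.
  by case: (x \in S); rewrite !(mul1r, mul0r, mulr0, add0r, addr0).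
apply: lerD; apply: sub.
- exact/fintype.subsetP.
- by move=> x y xS yA yS; rewrite zero// inE yS.
- exact: finset.subsetDl.
- move=> x y xAS yA; rewrite inE yA andbT negbK => yS.
  by rewrite (zero' y x).
Qed.

(** This removes the irreducibility constraint from [kappa]. Masses add over a closed subset and the
    rest of [A], and exit sums are subadditive, so [mean_exit A] is at most a weighted average over
    the two pieces. One piece does at least as well, and induction on the cardinality applies. *)
Lemma irreducible_subset A : A != finset.set0 -> A != [set: V]%SET ->
  exists B, [/\ B \subset A, B != finset.set0, irreducible_on P B &
    mean_exit A <= mean_exit B].
Proof.
have [n] := ubnP #|A|; elim: n A => // n IHn A An A0 AT.
have [irA|nirA] := pselect (irreducible_on P A); first by exists A; split.
have [S [SA S0 clS nSA]] : exists S, [/\ S \subset A, S != finset.set0,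
    closed_in P A S & S != A].
  apply: contrapT => nex; apply: nirA; apply: closed_irreducible trans_ge0 _ _.
  move=> S SA S0 clS; apply: contrapT => /eqP nSA; apply: nex.
  by exists S; split.
have ltS : S \proper A by rewrite finset.properEneq nSA.
have D0 : (A :\: S)%SET != finset.set0.
  by rewrite finset.setD_eq0; move: ltS; rewrite fintype.properE => /andP[].
have sDA : (A :\: S)%SET \subset A by exact: finset.subsetDl.
have ltD : (A :\: S)%SET \proper A.
  rewrite finset.properEneq sDA andbT; apply/eqP => DE; case/set0Pn: S0 => x xS.
  have := fintype.subsetP SA x xS; rewrite -DE inE xS //.
have sT (B : {set V}) : B \subset A -> B != [set: V]%SET.
  by move=> BA; rewrite -mass_lt1 (le_lt_trans (mass_le BA))// mass_lt1.
have step (B : {set V}) : B \proper A -> B != finset.set0 ->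
    mean_exit A <= mean_exit B ->
    exists B, [/\ B \subset A, B != finset.set0, irreducible_on P B &
    mean_exit A <= mean_exit B].
  move=> BA B0 AB; have [||C [CB C0 Cir BC]] := IHn B _ B0.
  - exact: leq_trans (fintype.proper_card BA) _.
  - exact: sT (fintype.proper_sub BA).
  exists C; split => //; first exact: fintype.subset_trans CB (fintype.proper_sub BA).
  exact: le_trans AB BC.
have [/(step _ ltS S0)//|lS] := leP (mean_exit A) (mean_exit S).
have [/(step _ ltD D0)//|lD] := leP (mean_exit A) (mean_exit (A :\: S)%SET).
have := exit_split AT SA clS.
have mE (B : {set V}) : B != finset.set0 ->
    \sum_x pi x * exit_fun B x = mean_exit B * mass pi B.
  by move=> B0; rewrite mulfVK// gt_eqF// mass_gt0.
rewrite !mE// leNgt => /negP[].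
have -> : mass pi A = mass pi S + mass pi (A :\: S)%SET.
  rewrite /mass (big_setID S) /=; congr (_ + _).
  by apply: eq_bigl => x; rewrite inE andb_idl// => /(fintype.subsetP SA).
by rewrite mulrDr ltrD// ltr_pM2r// mass_gt0.
Qed.

End ExitFunction.

(** * The Rayleigh quotient of the restricted chain *)

Lemma continuous_sumr (T : topologicalType) (R : realType) (I : Type)
    (r : seq I) (F : I -> T -> R) :
  (forall i, continuous (F i)) -> continuous (fun x => \sum_(i <- r) F i x).
Proof.
move=> cF; elim: r => [|i r IHr] x.
  rewrite (_ : (fun x => _) = fun=> 0); first exact: cvg_cst.
  by apply/funext => y; rewrite big_nil.
rewrite (_ : (fun x => _) = F i \+ (fun x => \sum_(i <- r) F i x)).
  by apply: continuousD; [exact: cF|exact: IHr].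
by apply/funext => y; rewrite big_cons.
Qed.

Lemma big_supported (R : nmodType) (V : finType) (B : {set V}) (F : V -> R) :
  (forall x, x \notin B -> F x = 0) ->
  \sum_x F x = \sum_(i < #|B|) F (enum_val i).
Proof.
move=> FB; rewrite -(big_enum_val (A := mem B) F) [RHS]big_mkcond; apply: eq_bigr => x _.
by case: ifPn => // /FB.
Qed.

Section Rayleigh.
Context {R : realType} {V : finType}.
Variables (P : V -> V -> R) (pi : V -> R).
Hypothesis chain : irreducible_reversible P pi.
Implicit Types (f g h : V -> R) (A B S : {set V}).

Let stP : stochastic P. Proof. by case: chain. Qed.
Let revP : reversible P pi. Proof. by case: chain. Qed.
Let pi_gt0 x : 0 < pi x. Proof. exact: stationary_gt0 chain x. Qed.

Definition sqnorm f := \sum_x pi x * f x ^+ 2.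

Lemma sqnorm_ge0 f : 0 <= sqnorm f.
Proof. by apply: sumr_ge0 => x _; rewrite mulr_ge0 ?sqr_ge0 ?ltW. Qed.

Lemma sqnorm_eq0 f : sqnorm f = 0 -> forall x, f x = 0.
Proof.
move=> /eqP; rewrite psumr_eq0 => [|y _]; last first.
  by rewrite mulr_ge0 ?sqr_ge0 ?ltW.
move=> /allP f0 x; have := f0 x; rewrite mem_index_enum => /(_ isT) /=.
by rewrite mulf_eq0 (gt_eqF (pi_gt0 x)) sqrf_eq0 => /eqP.
Qed.

Lemma energyZ f a : energy P pi (fun x => a * f x) (fun x => a * f x) =
  a ^+ 2 * energy P pi f f.
Proof. by rewrite energyZr energyC energyZr mulrA expr2. Qed.

Lemma sqnormZ f a : sqnorm (fun x => a * f x) = a ^+ 2 * sqnorm f.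
Proof. by rewrite /sqnorm mulr_sumr; apply: eq_bigr => x _; ring. Qed.

Lemma rayleigh_min_sphere B : B != finset.set0 ->
  exists2 f, supported f B /\ sqnorm f = 1 & forall g, supported g B ->
    sqnorm g = 1 -> energy P pi f f <= energy P pi g g.
Proof.
move=> /set0Pn[z zB].
pose fv (v : 'rV[R]_#|V|) x := v 0 (enum_rank x).
have cfv x : continuous (fun v => fv v x) by move=> v; exact: coord_continuous.
(* The support condition is a single equation for a continuous function, so that [K] is closed. *)
pose K : set 'rV[R]_#|V| :=
  [set v | sqnorm (fv v) = 1] `&` [set v | \sum_(x in ~: B) fv v x ^+ 2 = 0].
have KP v : K v <-> sqnorm (fv v) = 1 /\ supported (fv v) B.
  split=> -[n1 s0]; split => //=.
    move=> x xB; move/eqP: s0; rewrite psumr_eq0 => [|y _]; last exact: sqr_ge0.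
    move=> /allP/(_ x); rewrite mem_index_enum => /(_ isT) /=.
    by rewrite inE xB /= sqrf_eq0 => /eqP.
  by apply: big1 => x; rewrite inE => /s0 ->; rewrite expr0n.
have cM (F G : 'rV[R]_#|V| -> R) : continuous F -> continuous G ->
    continuous (fun v => F v * G v).
  by move=> cF cG v; exact: (cvgM (cF v) (cG v)).
have cB (F G : 'rV[R]_#|V| -> R) : continuous F -> continuous G ->
    continuous (fun v => F v - G v).
  by move=> cF cG v; exact: (cvgB (cF v) (cG v)).
have cc (a : R) : continuous (fun _ : 'rV[R]_#|V| => a).
  by move=> v; exact: cst_continuous.
have csq : continuous (fun v => sqnorm (fv v)).
  by apply: continuous_sumr => x; apply: (cM) => //; exact: (cM (fv^~ x) (fv^~ x)).
have csB : continuous (fun v => \sum_(x in ~: B) fv v x ^+ 2).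
  rewrite (_ : (fun v => _) = fun v =>
      \sum_x (x \in ~: B)%:R * (fv v x * fv v x)); last first.
    apply/funext => v; rewrite big_mkcond; apply: eq_bigr => x _.
    by case: (x \in _); rewrite ?mul1r ?mul0r.
  by apply: continuous_sumr => x; apply: (cM) => //; exact: (cM (fv^~ x) (fv^~ x)).
have cE : continuous (fun v => energy P pi (fv v) (fv v)).
  apply: (cM) => //; apply: continuous_sumr => x; apply: continuous_sumr => y.
  by apply: (cM) => //; apply: (cM); apply: (cB); exact: cfv.
have cK : compact K.
  apply: bounded_closed_compact; last first.
    have clE F (a : R) : continuous F -> closed [set v : 'rV[R]_#|V| | F v = a].
    move=> cF; apply: (@preimage_closed _ _ F [set y | y = a]) => [v _|].
      exact: cF.
    exact: closed_eq.
  by apply: closedI; exact: clE.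
  (* On [K] one has [fv v x ^+ 2 <= (pi x)^-1 <= M - 1], whence the absolute value of [fv v x] is at
     most [M]. *)
  pose M := 1 + \sum_x (pi x)^-1.
  exists M; split; first exact: num_real.
  move=> M' MM' v /KP[n1 _].
  have M0 : 0 <= M by rewrite addr_ge0// sumr_ge0// => x _; rewrite invr_ge0 ltW.
  change (mx_norm v <= M'); rewrite mx_normrE; apply/bigmax_leP; split.
    exact: le_trans (ltW MM').
  move=> [i j] _ /=; rewrite ord1 {i}; apply: le_trans (ltW MM').
  pose x := enum_val j; have -> : v 0 j = fv v x by rewrite /fv enum_valK.
  have : pi x * fv v x ^+ 2 <= 1.
    rewrite -n1 /sqnorm (bigD1 x)//= lerDl sumr_ge0// => y _.
    by rewrite mulr_ge0 ?sqr_ge0 ?ltW.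
  rewrite mulrC -ler_pdivlMr// div1r => h.
  have : (pi x)^-1 <= \sum_x (pi x)^-1.
    by rewrite (bigD1 x)//= lerDl sumr_ge0// => y _; rewrite invr_ge0 ltW.
  rewrite -(real_normK (num_real (fv v x))) in h.
  rewrite /M; have := normr_ge0 (fv v x); nra.
have K0 : K !=set0.
  pose c := Num.sqrt (pi z)^-1.
  exists (\row_i (c * (enum_val i == z)%:R)); apply/KP.
  have E x : fv (\row_i (c * (enum_val i == z)%:R)) x = c * (x == z)%:R.
    by rewrite /fv mxE enum_rankK.
  split; last by move=> x xB; rewrite E eq_sym (negbTE (memPn xB z zB)) mulr0.
  rewrite /sqnorm (bigD1 z)//= E eqxx mulr1 big1 ?addr0 => [|x /negbTE xz].
    by rewrite sqr_sqrtr ?invr_ge0 ?ltW// divff// gt_eqF.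
  by rewrite E xz mulr0 expr0n mulr0.
have [v vK vmin] := EVT_min_rV K0 cK (continuous_subspaceT cE).
rewrite inE in vK; move/KP: vK => [v1 vB].
exists (fv v) => // g gB g1.
pose w : 'rV[R]_#|V| := \row_i g (enum_val i).
have wE : fv w = g by apply/funext => x; rewrite /fv mxE enum_rankK.
by rewrite -wE; apply: vmin; rewrite inE; apply/KP; rewrite wE.
Qed.

Definition is_rayleigh_min B f := [/\ supported f B, sqnorm f = 1 &
  forall g, supported g B -> energy P pi f f * sqnorm g <= energy P pi g g].

Lemma rayleigh_min_exists B : B != finset.set0 -> exists f, is_rayleigh_min B f.
Proof.
move=> /rayleigh_min_sphere[f [fB f1] fmin]; exists f; split => // g gB.
have := sqnorm_ge0 g; rewrite le_eqVlt => /orP[/eqP <-|g0].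
  by rewrite mulr0 energy_ge0.
pose a := (Num.sqrt (sqnorm g))^-1.
have a2 : a ^+ 2 = (sqnorm g)^-1 by rewrite exprVn sqr_sqrtr// ltW.
have := fmin (fun x => a * g x); rewrite energyZ sqnormZ a2 mulVf ?gt_eqF//.
rewrite mulrC ler_pdivlMr//; apply => // x /gB ->; exact: mulr0.
Qed.

(** First variation at a single state: along [f + t * g], energy minus [l] times squared norm is a
    nonnegative quadratic in [t] without constant term, so its linear coefficient vanishes. *)
Lemma rayleigh_min_eigen B f : is_rayleigh_min B f ->
  forall x, x \in B -> \sum_y P x y * f y = (1 - energy P pi f f) * f x.
Proof.
move=> [fB f1 fmin] x xB; set l := energy P pi f f.
pose g y : R := (y == x)%:R.
have gB : supported g B.
  by move=> y yB; rewrite /g; case: eqP yB => // ->; rewrite xB.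
pose c := \sum_y pi y * (f y * g y).
have sqD t : sqnorm (fun y => f y + t * g y) =
    sqnorm f + 2 * c * t + sqnorm g * t ^+ 2.
  rewrite /sqnorm /c mulr_sumr !mulr_suml -!big_split; apply: eq_bigr => y _ /=.
  ring.
have : (energy P pi f g - l * c) ^+ 2 <= 0 * (energy P pi g g - l * sqnorm g).
  apply: discriminant_le => [|t]; first by rewrite subr_ge0 fmin.
  have : supported (fun y => f y + t * g y) B.
    by move=> y yB; rewrite fB// gB// mulr0 addr0.
  move=> /fmin; rewrite sqD f1 energyDr energyZr.
  rewrite !(energyC _ _ (fun x => f x + _)) !energyDr !energyZr.
  rewrite (energyC _ _ g f) -/l; lra.
rewrite mul0r => h.
have : energy P pi f g - l * c == 0.
  by rewrite -sqrf_eq0 eq_le h sqr_ge0.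
have sg F : \sum_y pi y * F y * g y = pi x * F x.
  rewrite (bigD1 x)//= /g eqxx mulr1 big1 ?addr0// => y /negbTE ->.
  exact: mulr0.
rewrite -inner_laplacian// /inner sg /c.
under [X in _ - l * X]eq_bigr do rewrite mulrA.
rewrite sg mulrCA -mulrBr mulf_eq0 (gt_eqF (pi_gt0 x)) /= subr_eq0 => /eqP h'.
by rewrite mulrBl mul1r -h' opprB addrC subrK.
Qed.

(** Matrix eigenvectors are row vectors. By reversibility, multiplying a function supported in [B]
    by [pi] turns the action of [P_B] on functions into its action on row vectors. An eigenfunction
    for [a] has Rayleigh quotient [1 - a], which is at least the minimum. *)
Lemma beta_rayleigh B f : is_rayleigh_min B f ->
  is_max [set a | eigenvalue (restr P B) a] (1 - energy P pi f f).
Proof.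
move=> fmin; have [fB f1 fle] := fmin; split.
  apply/eigenvalueP.
  pose v : 'rV[R]_#|B| := \row_i (pi (enum_val i) * f (enum_val i)).
  exists v.
    apply/rowP => j; rewrite !mxE.
    transitivity (pi (enum_val j) * \sum_y P (enum_val j) y * f y).
      rewrite mulr_sumr (big_supported (B := B)); last first.
        by move=> y /fB ->; rewrite !mulr0.
      apply: eq_bigr => i _; rewrite !mxE.
      by rewrite mulrAC revP mulrA.
    by rewrite (rayleigh_min_eigen fmin) ?enum_valP// mulrCA.
  apply/eqP => v0; have : sqnorm f = 0.
    apply: big1 => x _; have [xB|/fB ->] := boolP (x \in B); last first.
      by rewrite expr0n mulr0.
    have /rowP/(_ (enum_rank_in xB x)) := v0; rewrite !mxE enum_rankK_in//.
    by move=> h; rewrite expr2 mulrA h mul0r.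
  by rewrite f1 => /eqP; rewrite oner_eq0.
move=> a /= /eigenvalueP[v va v0].
pose g x := if [pick i : 'I_#|B| | enum_val i == x] is Some i then
  v 0 i / pi x else 0.
have gE i : g (enum_val i) = v 0 i / pi (enum_val i).
  rewrite /g; case: pickP => [j /eqP/enum_val_inj -> //|/(_ i)].
  by rewrite eqxx.
have gB : supported g B.
  move=> x xB; rewrite /g; case: pickP => // i /eqP ix.
  by move: xB; rewrite -ix enum_valP.
have eg x : x \in B -> \sum_y P x y * g y = a * g x.
  move=> xB; rewrite -(enum_rankK_in xB xB); set j := enum_rank_in xB x.
  apply: (mulfI (lt0r_neq0 (pi_gt0 (enum_val j)))).
  have := congr1 (fun w : 'rV_#|B| => w 0 j) va; rewrite !mxE => h.
  transitivity (a * v 0 j); last by rewrite gE; field; rewrite gt_eqF.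
  rewrite -h mulr_sumr (big_supported (B := B)); last first.
    by move=> y /gB ->; rewrite !mulr0.
  apply: eq_bigr => i _; rewrite !mxE gE mulrA revP.
  by field; rewrite gt_eqF.
have Eg : energy P pi g g = (1 - a) * sqnorm g.
  rewrite -inner_laplacian// /inner /sqnorm mulr_sumr; apply: eq_bigr => x _.
  have [xB|/gB ->] := boolP (x \in B); last by rewrite expr0n /= !mulr0.
  rewrite eg//; ring.
have g0 : 0 < sqnorm g.
  rewrite lt_neqAle sqnorm_ge0 andbT; apply: contra_neq v0 => /esym g0.
  apply/rowP => i; rewrite mxE; have := sqnorm_eq0 g0 (enum_val i).
  rewrite gE => /eqP; rewrite mulf_eq0 invr_eq0 (gt_eqF (pi_gt0 _)) orbF.
  by move=> /eqP.
have := fle _ gB; rewrite Eg ler_pM2r//; lra.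
Qed.

Lemma lambda_rayleigh B f : is_rayleigh_min B f ->
  lambda P B = energy P pi f f.
Proof.
move=> /beta_rayleigh m; rewrite /lambda /beta /maximum (xget_unique 0 m).
  by rewrite opprB addrCA subrr addr0.
move=> y [yA yub]; case: m => mA mub; apply/eqP.
by rewrite eq_le (mub _ yA) (yub _ mA).
Qed.

Lemma lambda_attained B : B != finset.set0 ->
  exists f, [/\ supported f B, 0 < sqnorm f &
    energy P pi f f = lambda P B * sqnorm f].
Proof.
move=> /rayleigh_min_exists[f fmin]; have [fB f1 _] := fmin.
by exists f; rewrite f1 mulr1 (lambda_rayleigh fmin).
Qed.

Lemma lambda_le B g : B != finset.set0 -> supported g B ->
  lambda P B * sqnorm g <= energy P pi g g.
Proof.
move=> /rayleigh_min_exists[f fmin] gB; rewrite (lambda_rayleigh fmin).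
by have [_ _] := fmin; apply.
Qed.

Lemma sqr_mean_le A g : supported g A ->
  (\sum_x pi x * g x) ^+ 2 <= mass pi A * sqnorm g.
Proof.
move=> gA; have m0 := mass_ge0 chain A.
apply: discriminant_le => [|t]; first exact: sqnorm_ge0.
have -> : mass pi A + 2 * (\sum_x pi x * g x) * t + sqnorm g * t ^+ 2 =
    \sum_x pi x * ((x \in A)%:R + t * g x) ^+ 2.
  rewrite /mass big_mkcond /sqnorm mulr_sumr !mulr_suml -!big_split.
  apply: eq_bigr => x _ /=; have [xA|/gA ->] := boolP (x \in A); rewrite /=; ring.
by apply: sumr_ge0 => x _; rewrite mulr_ge0 ?sqr_ge0 ?ltW.
Qed.

(** With [s] the exit sum and [n] the squared norm of [h], the bounds [lambda * n <= s] and
    [s ^ 2 <= pi(B) * n] combine to [lambda * s <= pi(B)]. *)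
Lemma lambda_mean_exit B : B != finset.set0 -> B != [set: V]%SET ->
  lambda P B <= (mean_exit P pi B)^-1.
Proof.
move=> B0 BT; have [hB hE] := exit_funP chain BT.
rewrite /mean_exit invf_div ler_pdivlMr ?(sum_exit_gt0 chain B0)//.
set h := exit_fun P B in hB hE *.
have s0 := sum_exit_gt0 chain B0 (conj hB hE).
rewrite -(ler_pM2r s0); have := sqr_mean_le hB; rewrite expr2.
have := lambda_le B0 hB.
rewrite (is_exit_energy chain (conj hB hE) hB).
have m0 : 0 < mass pi B by rewrite (mass_gt0 chain).
set l := lambda P B; set s := \sum_x _; have n0 := sqnorm_ge0 h.
(* Combining the two bounds uses [0 <= l]; for negative [l] the left side is nonpositive. *)
have [l0|l0] := leP 0 l; last first.
  by move=> _ _; rewrite -mulrA (@le_trans _ _ 0)//;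
    [rewrite nmulr_rle0// mulr_ge0// ltW|rewrite mulr_ge0// ltW].
by move=> h1 h2; rewrite -mulrA; nra.
Qed.

End Rayleigh.

(** * Mean hitting times *)

Section Survival.
Context {R : realType} {V : finType}.
Variables (P : V -> V -> R) (B : {set V}).

(** For [g = 1] this is the probability, from [x], that [X_1, ..., X_n] all lie in [B]; the starting
    point itself is not tested. *)
Fixpoint killed n (g : V -> R) x : R :=
  if n is n'.+1 then \sum_(y in B) P x y * killed n' g y else g x.

Hypothesis P_ge0 : forall x y, 0 <= P x y.

Lemma killed_ge0 n g : (forall x, 0 <= g x) -> forall x, 0 <= killed n g x.
Proof.
move=> g0; elim: n => //= n IHn x; apply: sumr_ge0 => y _.
by rewrite mulr_ge0.
Qed.

Lemma killed_leM n g a : (forall x, g x <= a) ->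
  forall x, killed n g x <= a * killed n (fun=> 1) x.
Proof.
move=> ga; elim: n => [|n IHn] x /=; first by rewrite mulr1.
rewrite mulr_sumr; apply: ler_sum => y _.
by rewrite mulrCA ler_wpM2l.
Qed.

Lemma is_exit_killed h n x : is_exit P B h -> x \in B ->
  killed n h x = killed n (fun=> 1) x + killed n.+1 h x.
Proof.
move=> [hB hE]; elim: n x => [|n IHn] x xB.
  rewrite /= -[LHS](subrK (\sum_y P x y * h y)) hE//; congr (_ + _).
  rewrite [RHS]big_mkcond; apply: eq_bigr => y _.
  by case: ifPn => // /hB ->; rewrite mulr0.
rewrite [LHS]/= (eq_bigr _ (fun y yB => congr1 ( *%R _) (IHn y yB))).
by under eq_bigr do rewrite mulrDr; rewrite big_split.
Qed.

Lemma is_exit_sum_killed h n x : is_exit P B h -> x \in B ->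
  h x = \sum_(i < n) killed i (fun=> 1) x + killed n h x.
Proof.
move=> hE xB; elim: n => [|n IHn]; first by rewrite big_ord0 add0r.
by rewrite big_ord_recr /= -addrA -[X in _ + (_ + X)]/(killed n.+1 h x)
  -is_exit_killed.
Qed.

(** The remainder after [n] terms is at most [M * c n], with [M] a bound for [h], and [c n] tends to
    0 because the partial sums are bounded by [L]. *)
Lemma series_killed (mu : V -> R) h : is_exit P B h ->
  (forall x, 0 <= mu x) -> (forall x, 0 <= h x) ->
  series (fun n => \sum_(x in B) mu x * killed n (fun=> 1) x) @ \oo -->
  \sum_(x in B) mu x * h x.
Proof.
move=> hE mu0 h0; set c := (fun n => _); set L := \sum_(x in B) _.
have sE n : series c n = L - \sum_(x in B) mu x * killed n h x.
  rewrite /series /= big_mkord /L -sumrB exchange_big; apply: eq_bigr => x xB.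
  by rewrite -mulrBr -mulr_sumr [h x](is_exit_sum_killed n hE xB) addrK.
have c0 n : 0 <= c n.
  by apply: sumr_ge0 => x _; rewrite mulr_ge0// killed_ge0.
have r0 n : 0 <= \sum_(x in B) mu x * killed n h x.
  by apply: sumr_ge0 => x _; rewrite mulr_ge0// killed_ge0.
have cs : cvgn (series c).
  apply: nondecreasing_is_cvgn; first exact: nondecreasing_series.
  by exists L => _ [n _ <-]; rewrite sE gerBl.
pose M := \sum_x h x.
have hM x : h x <= M by rewrite /M (bigD1 x)//= lerDl sumr_ge0.
have rc n : \sum_(x in B) mu x * killed n h x <= M * c n.
  rewrite mulr_sumr; apply: ler_sum => x _; rewrite mulrCA ler_wpM2l//.
  exact: killed_leM.
apply: (@squeeze_cvgr _ _ _ _ (fun n => L - M * c n) (fun=> L)).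
- apply: nearW => n; rewrite sE gerBl// r0 andbT lerD2l lerN2; exact: rc.
- rewrite -[X in _ --> X]subr0 -[X in _ - X](mulr0 M).
  apply: cvgB; first exact: cvg_cst.
  by apply: cvgM; [exact: cvg_cst|exact: cvg_series_cvg_0].
- exact: cvg_cst.
Qed.

End Survival.

(** * Survival probabilities and mean hitting times of a Markov chain *)

Section HittingTime.
Context {R : realType} {V : finType}.
Variables (P : V -> V -> R) (mu : V -> R) (B : {set V}).
Variables (d : measure_display) (Omega : measurableType d).
Variables (Q : probability Omega R) (X : nat -> Omega -> V).
Hypothesis XP : markov_chain P mu Q X.

Definition survival_event n : set Omega :=
  [set w | forall i, (i <= n)%N -> X i w \in B].

(** Prescribing the states up to time [k] lets the induction close: one step of the stay in [B]
    becomes one more prescribed state. *)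
Definition cylinder_event k n (x : nat -> V) : set Omega :=
  [set w | (forall i, (i <= k)%N -> X i w = x i) /\
     forall i, (k < i <= k + n)%N -> X i w \in B].

Let measurable_X i (D : {pred V}) : measurable [set w | X i w \in D].
Proof.
rewrite (_ : [set w | _] = \bigcup_(y in [set` D]) (X i @^-1` [set y])).
  by apply: fin_bigcup_measurable => // y _; have [+ _] := XP; exact.
by apply/seteqP; split=> [w|w [y yD] /= ->//]; exists (X i w).
Qed.

Let measurable_forall (J : pred nat) n (D : nat -> {pred V}) :
  measurable [set w | forall i, J i -> (i <= n)%N -> X i w \in D i].
Proof.
rewrite (_ : [set w | _] = \bigcap_(i in [set i | J i && (i <= n)%N])
    [set w | X i w \in D i]).
  apply: fin_bigcap_measurable => [|i _]; last exact: measurable_X.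
  apply: (sub_finite_set (B := `I_n.+1)) => // i /= /andP[_].
  by rewrite ltnS.
apply/seteqP; split=> w wD; first by move=> i /= /andP[]; exact: wD.
by move=> i Ji ni; apply: wD => /=; rewrite Ji.
Qed.

Lemma measurable_survival n : measurable (survival_event n).
Proof.
rewrite (_ : survival_event n =
    [set w | forall i, xpredT i -> (i <= n)%N -> X i w \in mem B]).
  exact: (@measurable_forall xpredT n (fun=> mem B)).
by apply/seteqP; split=> w /= wB i; [move=> _; exact: wB|exact: wB].
Qed.

Lemma measurable_cylinder k n x : measurable (cylinder_event k n x).
Proof.
rewrite (_ : cylinder_event k n x =
  [set w | forall i, xpredT i -> (i <= k)%N -> X i w \in pred1 (x i)] `&`
  [set w | forall i, (k < i)%N -> (i <= k + n)%N -> X i w \in mem B]).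
  by apply: measurableI; exact: measurable_forall.
apply/seteqP; split=> w /= [wx wB]; split.
- by move=> i _ /wx ->; rewrite inE.
- by move=> i ki ikn; apply: wB; rewrite ki.
- by move=> i /(wx i isT); rewrite inE => /eqP.
- by move=> i /andP[]; exact: wB.
Qed.

Lemma probability_cylinder k n x : Q (cylinder_event k n x) =
  (mu (x 0) * \prod_(i < k) P (x i) (x i.+1) * killed P B n (fun=> 1) (x k))%:E.
Proof.
elim: n k x => [|n IHn] k x.
  have [_ /(_ k x) XE] := XP; rewrite mulr1 -XE; congr (Q _).
  apply/seteqP; split=> w /=; first by case.
  by move=> wx; split => // i; rewrite addn0 ltnNge; case: leqP.
pose x' y i := if i == k.+1 then y else x i.
have x'le y i : (i <= k)%N -> x' y i = x i.
  by move=> ik; rewrite /x' ltn_eqF// ltnS.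
have -> : cylinder_event k n.+1 x =
    \bigcup_(y in [set` enum B]) cylinder_event k.+1 n (x' y).
  apply/seteqP; split=> w /=.
    move=> [wx wB]; exists (X k.+1 w).
      by rewrite /= mem_enum wB// ltnSn addnS ltnS leq_addr.
    split=> i; last first.
      by move=> /andP[ki ikn]; apply: wB; rewrite (ltnW ki) addnS -addSn.
    rewrite leq_eqVlt /x'; case: eqVneq => [-> //|_ /=].
    by rewrite ltnS; exact: wx.
  move=> [y /=]; rewrite mem_enum => yB [wx wB]; split=> i.
    by move=> ik; rewrite wx ?x'le// ltnW.
  move=> /andP[]; rewrite leq_eqVlt => /orP[/eqP <- _|ki ikn].
    by rewrite wx// /x' eqxx.
  by apply: wB; rewrite ki addSn -addnS.
rewrite measure_fin_bigcup//; last 2 first.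
- move=> y z _ _ [w [[wy _] [wz _]]].
  by have := wy k.+1 (leqnn _); rewrite wz// /x' eqxx.
- by move=> y _; exact: measurable_cylinder.
rewrite -fsbig_seq ?enum_uniq// big_enum /=.
under eq_bigr do rewrite IHn.
rewrite sumEFin; congr (_%:E); rewrite mulr_sumr; apply: eq_bigr => y yB.
rewrite big_ord_recr /= x'le// x'le//.
rewrite (eq_bigr (fun i : 'I_k => P (x i) (x i.+1))); last first.
  by move=> i _; rewrite !x'le// ltnW.
by rewrite /x' eqxx !mulrA.
Qed.

Lemma probability_survival n : Q (survival_event n) =
  (\sum_(x in B) mu x * killed P B n (fun=> 1) x)%:E.
Proof.
have -> : survival_event n =
    \bigcup_(y in [set` enum B]) cylinder_event 0 n (fun=> y).
  apply/seteqP; split=> w /=.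
    move=> wB; exists (X 0 w); first by rewrite /= mem_enum wB.
    by split=> i; [rewrite leqn0 => /eqP ->|move=> /andP[_]; exact: wB].
  move=> [y /=]; rewrite mem_enum => yB [wy wB] [|i] ni.
    by rewrite wy.
  exact: wB.
rewrite measure_fin_bigcup//; last 2 first.
- by move=> y z _ _ [w [[wy _] [wz _]]]; rewrite -(wy 0)// wz.
- by move=> y _; exact: measurable_cylinder.
rewrite -fsbig_seq ?enum_uniq// big_enum /=.
under eq_bigr do rewrite probability_cylinder big_ord0 mulr1.
by rewrite sumEFin.
Qed.

(** An integer-valued time is the sum over [n] of the indicators of [T > n]; on trajectories that
    stay in [B] both sides are [+oo]. *)
Lemma hitting_time_series w : hitting_time X (~: B)%SET w =
  (\sum_(0 <= n <oo) (\1_(survival_event n) w)%:E)%E :> \bar R.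
Proof.
have [[m mB]|nB] := pselect (exists m, X m w \notin B).
  pose m0 := ex_minn (ex_intro (fun m => X m w \notin B) m mB).
  have [m0B m0min] : X m0 w \notin B /\ forall i, X i w \notin B -> (m0 <= i)%N.
    by rewrite /m0; case: ex_minnP.
  have iE n : \1_(survival_event n) w = (n < m0)%N%:R :> R.
    rewrite indicE; congr (nat_of_bool _)%:R; apply/idP/idP.
      rewrite inE /survival_event /= => wB; rewrite ltnNge.
      by apply: contra m0B; exact: wB.
    move=> nm; rewrite inE => i ni /=; apply: contraTT nm => /m0min mi.
    by rewrite -leqNgt (leq_trans mi).
  have -> : hitting_time X (~: B)%SET w = m0%:R%:E :> \bar R.
    apply/eqP; rewrite eq_le; apply/andP; split.
      by apply: ereal_inf_lbound; exists m0 => //=; rewrite inE.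
    apply: le_ereal_inf_tmp => _ [i /= + <-]; rewrite inE => /m0min mi.
    by rewrite lee_fin ler_nat.
  rewrite (nneseries_split 0 m0)//.
  rewrite eseries0 ?adde0; last first.
    by move=> i; rewrite add0n iE => m0i _; rewrite ltnNge m0i.
  rewrite add0n big_nat (eq_bigr (fun=> 1%:E)); last first.
    by move=> i /andP[_ im]; rewrite iE im.
  by rewrite -big_nat sumEFin big_const_nat subn0 iter_addr addr0.
have -> : hitting_time X (~: B)%SET w = +oo%E :> \bar R.
  rewrite /hitting_time (_ : [set m | X m w \in (~: B)%SET] = set0).
    by rewrite image_set0 ereal_inf0.
  by apply/seteqP; split=> // i /=; rewrite inE => iB; case: nB; exists i.
apply/esym/eqyP => r r0.
apply: (@le_trans _ _ (\sum_(0 <= n < (Num.bound r)) (\1_(survival_event n) w)%:E)%E).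
  rewrite (eq_bigr (fun=> 1%:E)); last first.
    move=> n _; rewrite indicE mem_set// => i _.
    by apply: contrapT => /negP iB; apply: nB; exists i.
  rewrite sumEFin big_const_nat subn0 iter_addr addr0 lee_fin.
  by rewrite ltW// archi_boundP// ltW.
by apply: nneseries_lim_ge => n _ _; rewrite lee_fin.
Qed.

(** The series of indicators is integrated term by term, and [series_killed] sums the survival
    probabilities. *)
Lemma mean_hitting_time h : (forall x y, 0 <= P x y) -> is_exit P B h ->
  (forall x, 0 <= mu x) -> (forall x, 0 <= h x) ->
  (\int[Q]_w hitting_time X (~: B)%SET w = (\sum_(x in B) mu x * h x)%:E)%E.
Proof.
move=> P0 hE mu0 h0; under eq_integral do rewrite hitting_time_series.
rewrite integral_nneseries//; last first.
  move=> n; apply/measurable_realfun.measurable_EFinP.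
  apply: measurable_realfun.measurable_indic.
  exact: measurable_survival.
rewrite (eq_eseriesr (g := fun n =>
    (\sum_(x in B) mu x * killed P B n (fun=> 1) x)%:E)); last first.
  move=> n _; rewrite integral_indic//; last exact: measurable_survival.
  by rewrite setIT; exact: probability_survival.
apply/cvg_lim => //; apply: cvg_EFin.
  by apply: nearW => n; rewrite sumEFin.
rewrite (_ : _ \o _ = series (fun n =>
    \sum_(x in B) mu x * killed P B n (fun=> 1) x)).
  exact: series_killed.
by apply/funext => n; rewrite /= sumEFin.
Qed.

End HittingTime.

(** * Dyadic level sets *)

(* The last condition makes [4 ^ j * m_j * phi m_j], for [m_j] the mass of a
   dyadic level set, shrink geometrically unless it is paid for by the energy. *)
Definition profile (R : realType) (C a : R) (phi : R -> R) :=
  [/\ forall p, 0 < p <= a -> 0 <= phi p,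
      forall p q, 0 < p -> p <= q -> q <= a -> phi q <= phi p &
      forall p q, 0 < p -> p <= q -> q <= a ->
        4 * p * phi p <= C * (phi q * p ^+ 2 / q) + 7 / 16 * (q * phi q)].

Section Profiles.
Context {R : realType}.
Implicit Types a K m p q : R.

Lemma profile_cst K : 0 <= K -> profile 1728 1 (fun=> K).
Proof.
move=> K0; split => // p q p0 pq _.
have q0 : 0 < q by exact: lt_le_trans pq.
have -> : 4 * p * K = K / q * (4 * p * q) by field; rewrite gt_eqF.
have -> : 1728 * (K * p ^+ 2 / q) + 7 / 16 * (q * K) =
  K / q * (1728 * p ^+ 2 + 7 / 16 * q ^+ 2) by field; rewrite gt_eqF.
rewrite ler_wpM2l//; first by rewrite divr_ge0 ?(ltW q0).
have := sqr_ge0 (4 * p - q / 2); have := sqr_ge0 p; have := sqr_ge0 q; lra.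
Qed.

Lemma ln_le_subr1 (x : R) : 0 < x -> ln x <= x - 1.
Proof.
by move=> x0; have := @le_ln1Dx R (x - 1); rewrite [1 + _]addrC subrK; apply; lra.
Qed.

Lemma ln2_ge_half : 2^-1 <= ln 2 :> R.
Proof.
have := @ln_le_subr1 2^-1; rewrite invr_gt0 ltr0n lnV ?posrE ?ltr0n//.
by move=> /(_ isT); lra.
Qed.

Lemma ln_inv_ge_half p : 0 < p -> p <= 1 / 2 -> 2^-1 <= ln (1 / p).
Proof.
move=> p0 ph; apply: (le_trans ln2_ge_half).
by rewrite ler_ln ?posrE ?divr_gt0// ler_pdivlMr//; lra.
Qed.

(** With [s = q / p] and [L = ln (1 / q)], division by [m * p] leaves [4 * (L + ln s) <= (1728 / s +
    7 / 16 * s) * L]. Since [L >= 1 / 2], the term [4 * ln s] is at most [8 * ln s * L]. *)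
Lemma profile_log m : 0 <= m -> profile 1728 (1 / 2) (fun p => m * ln (1 / p)).
Proof.
move=> m0; split=> [p /andP[p0 pa]|p q p0 pq qa|p q p0 pq qa].
- by rewrite mulr_ge0//; have := ln_inv_ge_half p0 pa; lra.
- rewrite ler_wpM2l// ler_ln ?posrE ?divr_gt0 ?(lt_le_trans p0 pq)//.
  by rewrite ler_pdivlMr// mulrC mulrA mulr1 ler_pdivrMr ?mul1r// (lt_le_trans p0).
have q0 : 0 < q by exact: lt_le_trans pq.
have L2 := ln_inv_ge_half q0 qa; set L := ln (1 / q) in L2 *.
set s := q / p.
have s1 : 1 <= s by rewrite ler_pdivlMr// mul1r.
have s0 : 0 < s by lra.
have -> : ln (1 / p) = L + ln s.
  rewrite -lnM ?posrE ?divr_gt0//; congr ln; rewrite /s; field.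
  by rewrite !gt_eqF.
(* Tangent line of [ln] at 32, with [ln 32 <= 5]. Its slope [1 / 4] leaves [3 / 16] of the [7 / 16]
   for [key]. *)
have lns : 8 * ln s <= s / 4 + 32.
  have := @ln_le_subr1 (s / 32); rewrite divr_gt0// => /(_ isT).
  rewrite ln_div ?posrE ?ltr0n//.
  have : ln 32 <= 5 :> R.
    rewrite (_ : 32 = 2 ^+ 5); last by ring.
    rewrite lnXn// -[ln 2 *+ 5]mulr_natr.
    by have := @ln_le_subr1 2; rewrite ltr0n => /(_ isT); lra.
  lra.
have lns0 : 0 <= ln s by rewrite ln_ge0.
have -> : q = s * p by rewrite /s mulfVK// gt_eqF.
have -> : 1728 * (m * L * p ^+ 2 / (s * p)) = m * p * (1728 * (L / s)).
  by field; rewrite !gt_eqF.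
have -> : 7 / 16 * (s * p * (m * L)) = m * p * (7 / 16 * (s * L)) by ring.
rewrite (_ : 4 * p * (m * (L + ln s)) = m * p * (4 * (L + ln s))); last by ring.
rewrite -mulrDr ler_wpM2l//; first by rewrite mulr_ge0// ltW.
have si : s * s^-1 = 1 by rewrite divff// gt_eqF.
have i0 : 0 < s^-1 by rewrite invr_gt0.
(* After multiplication by [s] this is [3 / 16 * (s - 96) ^ 2 >= 0], which is where 1728 comes
   from. *)
have key : 36 <= 1728 * s^-1 + 3 / 16 * s.
  rewrite -(ler_pM2r s0) [leRHS]mulrDl -[X in X + _]mulrA [s^-1 * s]mulrC si.
  have := sqr_ge0 (s - 96); nra.
have h1 : 4 * ln s <= 8 * ln s * L by nra.
have h2 : 8 * ln s * L <= (s / 4 + 32) * L by rewrite ler_wpM2r//; lra.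
have h3 : 36 * L <= (1728 * s^-1 + 3 / 16 * s) * L by rewrite ler_wpM2r//; lra.
lra.
Qed.

End Profiles.

(** * Slices of a number between the heights [s] and [2 * s] *)

Section DyadicTruncation.
Context {R : realType}.
Implicit Types (s z a b e : R).

Definition slice s z : R := Num.min (Num.max (z - s) 0) s.

Lemma slice_ge0 s z : 0 <= s -> 0 <= slice s z.
Proof. by move=> s0; rewrite le_min s0 le_max lexx orbT. Qed.

Lemma slice_min s z : 0 <= s -> Num.min z s + slice s z = Num.min z (2 * s).
Proof.
by move=> s0; rewrite /slice /Num.min /Num.max; do ?case: ifP => /=; lra.
Qed.

Lemma le_slice s : {homo slice s : a b / a <= b}.
Proof.
by move=> a b ab; rewrite /slice le_min2// le_max2// lerB.
Qed.

(** The slices of [z] telescope to [min(z, e * 2 ^ N) - min(z, e)], a 1-Lipschitz function of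
    [z]. *)
Lemma sum_slice e N a b : 0 <= e -> b <= a ->
  \sum_(i < N) (slice (e * 2 ^+ i) a - slice (e * 2 ^+ i) b) <= a - b.
Proof.
move=> e0 ba; have E z : 0 <= e -> \sum_(i < N) slice (e * 2 ^+ i) z =
    Num.min z (e * 2 ^+ N) - Num.min z e.
  move=> _; elim: N => [|N IHN]; first by rewrite big_ord0 expr0 mulr1 subrr.
  rewrite big_ord_recr /= IHN addrAC slice_min; last first.
    by rewrite mulr_ge0 ?exprn_ge0.
  by congr (Num.min _ _ - _); rewrite exprS; ring.
rewrite sumrB !E//; rewrite /Num.min; have : e <= e * 2 ^+ N.
  by rewrite ler_peMr// exprn_ege1// ler1n.
by do ?case: ifP => /=; lra.
Qed.

Lemma sum_sqr_le (I : finType) (F : I -> R) : (forall i, 0 <= F i) ->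
  \sum_i F i ^+ 2 <= (\sum_i F i) ^+ 2.
Proof.
move=> F0; rewrite expr2 mulr_suml; apply: ler_sum => i _.
rewrite expr2 ler_wpM2l// (bigD1 i)//= lerDl sumr_ge0//.
Qed.

(** All slice increments have the same sign, so their squares sum to at most the square of their
    sum. *)
Lemma sum_slice_sqr e N a b : 0 <= e ->
  \sum_(i < N) (slice (e * 2 ^+ i) a - slice (e * 2 ^+ i) b) ^+ 2 <=
  (a - b) ^+ 2.
Proof.
move=> e0; wlog ba : a b / b <= a => [h|].
  have [/h//|/ltW/h] := leP b a.
  by rewrite -[(b - a) ^+ 2]sqrrN opprB; under eq_bigr do rewrite -sqrrN opprB.
have F0 (i : 'I_N) : 0 <= slice (e * 2 ^+ i) a - slice (e * 2 ^+ i) b.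
  by rewrite subr_ge0 le_slice.
apply: (le_trans (sum_sqr_le F0)); rewrite lerXn2r ?nnegrE ?subr_ge0//.
  by rewrite sumr_ge0.
exact: sum_slice.
Qed.

End DyadicTruncation.

(** * The weighted energy inequality over level sets *)

Section LevelSets.
Context {R : realType} {V : finType}.
Variables (P : V -> V -> R) (pi : V -> R).
Hypothesis chain : irreducible_reversible P pi.
Implicit Types (f g h u : V -> R) (A B S : {set V}).

Let stP : stochastic P. Proof. by case: chain. Qed.
Let pi_gt0 x : 0 < pi x. Proof. exact: stationary_gt0 chain x. Qed.

(** Starting at such an [e] makes the first two level sets both equal to [{u > 0}]. *)
Lemma dyadic_scale u : exists2 e : R, 0 < e & forall x, 0 < u x -> 2 * e < u x.
Proof.
pose S : R := 1 + \sum_(x | 0 < u x) (u x)^-1.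
have S0 : 0 < S.
  by rewrite ltr_pwDl ?ltr01// sumr_ge0// => x /ltW; rewrite invr_ge0.
exists (S^-1 / 2) => [|x ux]; first by rewrite divr_gt0 ?invr_gt0.
have -> : 2 * (S^-1 / 2) = S^-1 by field; rewrite gt_eqF.
rewrite -[ltRHS]invrK ltf_pV2 ?posrE ?invr_gt0//.
rewrite /S (bigD1 x)//= addrCA ltrDl ltr_pwDl ?ltr01// sumr_ge0// => y.
by move=> /andP[/ltW]; rewrite invr_ge0.
Qed.

(** The exponent [N.+2] leaves at least two levels, so that [b 0] and [b 1] both occur in the sum of
    [profile_sum_le]. *)
Lemma dyadic_height u (e : R) : 0 < e -> (forall x, 0 <= u x) ->
  exists N, forall x, u x <= e * 2 ^+ N.+2.
Proof.
move=> e0 u0; pose M := \sum_x u x / e.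
exists (Num.bound M) => x; rewrite mulrC -ler_pdivrMr//.
apply: (@le_trans _ _ M).
  by rewrite /M (bigD1 x)//= lerDl sumr_ge0// => y _; rewrite divr_ge0 ?(ltW e0).
by rewrite ltW// upper_nthrootP// -addn2 leq_addr.
Qed.

(** The weights obey [b j.+1 <= C * energy + 7 / 16 * b j], with the energy of slice [j]; summing
    over [j] absorbs the last term. If [t j < u x <= t j.+1], the level set in the statement
    contains [A j], so [phi] of its mass is at most [phi (m j)]. *)
Lemma profile_sum_le C a (phi : R -> R) u : 0 <= C -> profile C a phi ->
  (forall x, 0 <= u x) -> mass pi [set x | (0 < u x)%R]%SET <= a ->
  (forall A g, A != finset.set0 -> A \subset [set x | (0 < u x)%R]%SET ->
    supported g A -> phi (mass pi A) * (\sum_x pi x * g x) ^+ 2 <=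
    mass pi A * energy P pi g g) ->
  \sum_x pi x * (u x ^+ 2 * phi (mass pi [set z | (u x <= 2 * u z)%R]%SET)) <=
  13 * C * energy P pi u u.
Proof.
move=> C0 [phi0 phi_anti phi_step] u0 ua cap.
have [e e0 eu] := dyadic_scale u; have [N0 uN] := dyadic_height e0 u0.
set N := N0.+2 in uN.
pose t j : R := e * 2 ^+ j.
have t0 j : 0 < t j by rewrite mulr_gt0// exprn_gt0.
have tS j : t j.+1 = 2 * t j by rewrite /t exprS; ring.
pose A j : {set V} := [set x | t j < u x]%SET.
have Apos j : A j \subset [set x | (0 < u x)%R]%SET.
  by apply/fintype.subsetP => x; rewrite !inE; exact: lt_trans.
have AS j : A j.+1 \subset A j.
  apply/fintype.subsetP => x; rewrite !inE; apply: lt_trans.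
  by rewrite tS; have := t0 j; lra.
pose m j := mass pi (A j).
have m0 j : 0 <= m j by exact: mass_ge0 chain _.
have ma j : m j <= a by apply: le_trans ua; exact: (mass_le chain).
have mS j : m j.+1 <= m j by exact: (mass_le chain).
pose b j := t j ^+ 2 * (m j * phi (m j)).
have phim j : 0 < m j -> 0 <= phi (m j) by move=> mj; rewrite phi0// mj ma.
have b0 j : 0 <= b j.
  rewrite mulr_ge0 ?sqr_ge0//; have := m0 j; rewrite le_eqVlt.
  by move=> /orP[/eqP <-|mj]; rewrite ?mul0r// mulr_ge0// phim.
pose f j x := slice (t j) (u x).
have fA j : supported (f j) (A j).
  move=> x; rewrite inE -leNgt /f /slice => ux.
  by rewrite max_r ?subr_le0// min_l// ltW.
have fS j x : x \in A j.+1 -> t j <= f j x.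
  rewrite inE tS => ux; rewrite le_min lexx andbT le_max.
  by apply/orP; left; lra.
have fsum j : t j * m j.+1 <= \sum_x pi x * f j x.
  rewrite mulrC /m /mass mulr_suml big_mkcond /=; apply: ler_sum => x _.
  case: ifPn => [xA|_]; first by rewrite ler_wpM2l ?(ltW (pi_gt0 x)) ?fS.
  by rewrite mulr_ge0 ?(ltW (pi_gt0 x))// slice_ge0// ltW.
(* The slice is at least [t j] on [A j.+1], so capacity on [A j] bounds the first term of the
   profile condition. The factor 4 in that condition is [(t j.+1 / t j) ^ 2]. *)
have bS j : b j.+1 <= C * energy P pi (f j) (f j) + 7 / 16 * b j.
  have := m0 j.+1; rewrite le_eqVlt => /orP[/eqP mj|mj].
    have -> : b j.+1 = 0 by rewrite /b -mj mul0r mulr0.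
    have := energy_ge0 stP pi_gt0 (f j) => E0; have := mulr_ge0 C0 E0.
    by have := b0 j; lra.
  have mj' : 0 < m j by exact: lt_le_trans (mS j).
  have Aj : A j != finset.set0 by rewrite -(mass_gt0 chain).
  have cj := cap _ _ Aj (Apos j) (fA j).
  have step := phi_step _ _ mj (mS j) (ma j).
  have E : t j ^+ 2 * (phi (m j) * m j.+1 ^+ 2 / m j) <=
      energy P pi (f j) (f j).
    rewrite mulrA ler_pdivrMr// [leRHS]mulrC; apply: le_trans cj.
    have tm0 : 0 <= t j * m j.+1 by rewrite mulr_ge0// ltW.
    rewrite mulrCA ler_wpM2l ?phim// -exprMn lerXn2r ?nnegrE ?fsum//.
    exact: le_trans (fsum j).
  rewrite /b tS exprMn.
  have := ler_wpM2l (sqr_ge0 (t j)) step; have := ler_wpM2l C0 E.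
  rewrite mulrDr; lra.
pose S := \sum_(j < N) b j.
have bN : b N = 0.
  rewrite /b /m (_ : A N = finset.set0) ?/mass ?big_set0 ?mul0r ?mulr0//.
  by apply/setP => x; rewrite !inE ltNge uN.
(* Levels 0 and 1 cut out the same set. With [S01] this bounds the boundary term [b 0] by
   [S / 5]. *)
have b01 : 4 * b 0 = b 1.
  have -> : b 1 = (2 * t 0) ^+ 2 * (m 0 * phi (m 0)).
    rewrite /b tS; suff -> : m 1 = m 0 by [].
    congr (mass _ _); apply/setP => x; rewrite !inE tS /t expr0 mulr1.
    by apply/idP/idP => h; [lra|apply: eu; exact: lt_trans h].
  by rewrite /b; ring.
have Sshift : \sum_(j < N) b j.+1 = S - b 0.
  have : \sum_(j < N.+1) b j = S by rewrite big_ord_recr /= bN addr0.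
  by rewrite big_ord_recl /= => <-; rewrite addrC addKr.
have S01 : b 0 + b 1 <= S.
  rewrite /S /N !big_ord_recl /= addrA lerDl sumr_ge0 //.
have SE : S - b 0 <= C * energy P pi u u + 7 / 16 * S.
  rewrite -Sshift /S; apply: (le_trans (ler_sum _ (fun (i : 'I_N) _ => bS i))).
  rewrite big_split /= -[X in X + _]mulr_sumr -[X in _ + X]mulr_sumr lerD2r ler_wpM2l//.
  apply: (ler_sum_energy stP pi_gt0 (f := fun i : 'I_N => f i)) => x y.
  exact: sum_slice_sqr (ltW e0).
(* From [b 0 <= S / 5] and [SE], [(1 - 1/5 - 7/16) * S] is at most [C] times the energy, and
   [4 / (1 - 1/5 - 7/16) = 320/29 < 13]. *)
apply: (@le_trans _ _ (4 * S)); last first.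
  have := mulr_ge0 C0 (energy_ge0 stP pi_gt0 u); have := b0 0; lra.
apply: (@le_trans _ _ (\sum_x \sum_(j < N)
    (x \in A j)%:R * (4 * t j ^+ 2 * phi (m j)) * pi x)).
  apply: ler_sum => x _; have term0 (j : 'I_N) :
      0 <= (x \in A j)%:R * (4 * t j ^+ 2 * phi (m j)) * pi x.
    have [xA|_] := boolP (x \in A j); last by rewrite !mul0r.
    have mj : 0 < m j by rewrite (mass_gt0 chain); apply/set0Pn; exists x.
    by rewrite mul1r mulr_ge0 ?(ltW (pi_gt0 x))// mulr_ge0 ?phim// mulr_ge0 ?sqr_ge0.
  have := u0 x; rewrite le_eqVlt => /orP[/eqP <-|ux].
    by rewrite expr0n /= mul0r mulr0 sumr_ge0.
  have [j jN /andP[tj jt]] : exists2 j, (j < N)%N & t j < u x <= t j.+1.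
    have ex : exists k, u x <= t k by exists N; exact: uN.
    case: (ex_minnP ex) => -[|j] uk kmin.
      by have := eu x ux; move: uk; rewrite /t expr0; lra.
    exists j; first exact: kmin (uN x).
    by rewrite uk andbT ltNge; apply/negP => /kmin; rewrite ltnn.
  have xA : x \in A j by rewrite inE.
  have mj : 0 < m j by rewrite (mass_gt0 chain); apply/set0Pn; exists x.
  rewrite (bigD1 (Ordinal jN))//= (le_trans (y := 4 * t j ^+ 2 * phi (m j) * pi x))//.
    rewrite mulrC ler_wpM2r ?(ltW (pi_gt0 _))//; apply: ler_pM.
    - exact: sqr_ge0.
    - apply: phi0; rewrite (mass_gt0 chain); apply/andP; split.
        by apply/set0Pn; exists x; rewrite inE; lra.
      apply: le_trans ua; apply: (mass_le chain); apply/fintype.subsetP => z.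
      by rewrite !inE; lra.
    - rewrite tS in jt; rewrite (_ : 4 * t j ^+ 2 = (2 * t j) ^+ 2); last by ring.
      by rewrite lerXn2r ?nnegrE ?u0// mulr_ge0// ltW.
    - apply: phi_anti => //.
        apply: (mass_le chain); apply/fintype.subsetP => z; rewrite !inE.
        by move: jt; rewrite tS; lra.
      apply: le_trans ua; apply: (mass_le chain); apply/fintype.subsetP => z.
      by rewrite !inE; lra.
  by rewrite xA mul1r lerDl sumr_ge0.
rewrite exchange_big /S mulr_sumr; apply: ler_sum => j _.
rewrite /b {2}/m /mass mulr_suml !mulr_sumr [leRHS]big_mkcond.
apply: ler_sum => x _; case: ifPn => _; last by rewrite !mul0r.
by rewrite mul1r le_eqVlt; apply/orP; left; apply/eqP; ring.
Qed.

End LevelSets.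

(** * Entropy *)

Section EntropyTerm.
Context {R : realType}.
Implicit Types (z c mu q t L : R).

Lemma subr1_le_ln t : 0 < t -> 1 - t^-1 <= ln t.
Proof.
move=> t0; have := @ln_le_subr1 R t^-1; rewrite invr_gt0 lnV ?posrE//.
by move=> /(_ t0); lra.
Qed.

(** The Bregman divergence of [z * ln z] between [z] and [c]. *)
Definition entropy_term z c := z * ln (z / c) - z + c.

(** For [r = z / mu], the logarithm is at most [2 * ln r <= 2 * (r - 1)], and the resulting
    polynomial factors as [(2 * r + 1) * (z - mu) ^ 2 + q], with [2 * r + 1 <= 5]. *)
Lemma entropy_term_low z mu q : 0 <= z -> 0 <= q -> 0 < mu ^+ 2 + q ->
  z <= 2 * mu -> entropy_term (z ^+ 2) (mu ^+ 2 + q) <= 5 * (z - mu) ^+ 2 + q.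
Proof.
rewrite le_eqVlt => /orP[/eqP <- q0 _ _|z0 q0 c0 zmu].
  rewrite /entropy_term expr0n /= mul0r.
  by have := sqr_ge0 mu; rewrite [0 - mu]sub0r sqrrN; lra.
have mu0 : 0 < mu by lra.
pose r := z / mu; have zE : z = r * mu by rewrite /r mulfVK// gt_eqF.
have r0 : 0 < r by rewrite divr_gt0.
have r2 : r <= 2 by rewrite ler_pdivrMr.
have h1 : ln (z ^+ 2 / (mu ^+ 2 + q)) <= 2 * (r - 1).
  apply: (@le_trans _ _ (ln (r ^+ 2))).
    rewrite ler_ln ?posrE ?divr_gt0 ?exprn_gt0// ler_pdivrMr//.
    rewrite zE exprMn ler_wpM2l ?sqr_ge0//; lra.
  by rewrite lnXn// -[ln r *+ 2]mulr_natl ler_wpM2l//; exact: ln_le_subr1.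
have h2 : z ^+ 2 * ln (z ^+ 2 / (mu ^+ 2 + q)) <= z ^+ 2 * (2 * (r - 1)).
  by rewrite ler_wpM2l ?sqr_ge0.
rewrite /entropy_term.
apply: (@le_trans _ _ (z ^+ 2 * (2 * (r - 1)) - z ^+ 2 + (mu ^+ 2 + q))).
  by rewrite lerD2r lerD2r.
have -> : z ^+ 2 * (2 * (r - 1)) - z ^+ 2 + (mu ^+ 2 + q) =
  (2 * r + 1) * (z - mu) ^+ 2 + q by rewrite zE; ring.
by rewrite lerD2r ler_wpM2r ?sqr_ge0//; lra.
Qed.

(** Above [2 * mu] one has [z <= 2 * (z - mu)], and [- z ^ 2 + mu ^ 2] is nonpositive. *)
Lemma entropy_term_high z mu q L : 0 <= mu -> 0 < q -> 2 * mu < z -> 0 <= L ->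
  ln (4 * (z - mu) ^+ 2 / q) <= L ->
  entropy_term (z ^+ 2) (mu ^+ 2 + q) <= 4 * (z - mu) ^+ 2 * L + q.
Proof.
move=> mu0 q0 muz L0 hL.
have z0 : 0 < z by lra.
have c0 : 0 < mu ^+ 2 + q by have := sqr_ge0 mu; lra.
have zu : z ^+ 2 <= 4 * (z - mu) ^+ 2.
  by rewrite (_ : 4 * _ = (2 * (z - mu)) ^+ 2); [rewrite lerXn2r ?nnegrE; lra|ring].
have h1 : ln (z ^+ 2 / (mu ^+ 2 + q)) <= L.
  apply: le_trans hL; rewrite ler_ln ?posrE ?divr_gt0 ?exprn_gt0//; last first.
    by apply: lt_le_trans zu; rewrite exprn_gt0.
  apply: ler_pM => //; rewrite ?sqr_ge0 ?invr_ge0 ?(ltW c0)//.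
  by rewrite lef_pV2 ?posrE// lerDr sqr_ge0.
have h2 : z ^+ 2 * ln (z ^+ 2 / (mu ^+ 2 + q)) <= 4 * (z - mu) ^+ 2 * L.
  apply: (@le_trans _ _ (z ^+ 2 * L)); first by rewrite ler_wpM2l ?sqr_ge0.
  by rewrite ler_wpM2r.
have h3 : mu ^+ 2 <= z ^+ 2 by rewrite lerXn2r ?nnegrE; lra.
by rewrite /entropy_term; lra.
Qed.

End EntropyTerm.

Section Entropy.
Context {R : realType} {V : finType}.
Variables (P : V -> V -> R) (pi : V -> R).
Hypothesis chain : irreducible_reversible P pi.
Implicit Types (f g h u : V -> R) (A B S : {set V}).

Let stP : stochastic P. Proof. by case: chain. Qed.
Let pi_gt0 x : 0 < pi x. Proof. exact: stationary_gt0 chain x. Qed.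
Let pi_ge0 x : 0 <= pi x. Proof. exact/ltW. Qed.
Let pi1 : \sum_x pi x = 1. Proof. by case: chain => _ _ []. Qed.

(** Nonnegativity of the relative entropy of the law with density [g / M] with respect to [pi]
    conditioned on [A], from [1 - 1 / t <= ln t] at each state. *)
Lemma Ent_ge g A : (forall x, 0 <= g x) -> supported g A ->
  0 < \sum_x pi x * g x -> (\sum_x pi x * g x) * ln (1 / mass pi A) <= Ent pi g.
Proof.
move=> g0 gA; rewrite /Ent; set M := \sum_x pi x * g x => M0.
have A0 : 0 < mass pi A.
  rewrite (mass_gt0 chain); apply/eqP => A0; move: M0; rewrite /M big1 ?ltxx//.
  by move=> x _; rewrite gA ?mulr0// A0 inE.
have -> : M * ln (1 / mass pi A) = \sum_x
    (pi x * g x * ln (1 / mass pi A) + pi x * g x -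
     (x \in A)%:R * pi x * (M / mass pi A)).
  rewrite sumrB big_split /= -!mulr_suml -/M.
  have -> : \sum_x (x \in A)%:R * pi x = mass pi A.
    rewrite /mass [RHS]big_mkcond; apply: eq_bigr => x _.
    by case: (x \in A); rewrite ?mul1r ?mul0r.
  by rewrite (_ : mass pi A * (M / mass pi A) = M) ?addrK//; field; rewrite gt_eqF.
apply: ler_sum => x _; have := g0 x; rewrite le_eqVlt => /orP[/eqP <-|gx].
  rewrite !(mulr0, mul0r) add0r sub0r oppr_le0.
  by rewrite mulr_ge0 ?divr_ge0 ?(ltW M0) ?(ltW A0)// mulr_ge0.
have xA : x \in A by apply: contraTT gx => /gA ->; rewrite ltxx.
rewrite xA (mul1r (pi x)).
have -> : ln (g x / M) = ln (1 / mass pi A) + ln (g x * mass pi A / M).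
  rewrite -lnM ?posrE ?divr_gt0 ?mulr_gt0//; congr ln; field.
  by rewrite !gt_eqF.
have := @subr1_le_ln R (g x * mass pi A / M); rewrite divr_gt0 ?mulr_gt0//.
move=> /(_ isT) /(ler_wpM2l (ltW (mulr_gt0 (pi_gt0 x) gx))).
have -> : pi x * g x * (1 - (g x * mass pi A / M)^-1) =
    pi x * g x - pi x * (M / mass pi A) by field; rewrite !gt_eqF.
by rewrite mulrDr; lra.
Qed.

Lemma Ent_null g : (forall x, 0 <= g x) -> \sum_x pi x * g x = 0 -> Ent pi g = 0.
Proof.
move=> g0 /eqP; rewrite psumr_eq0 => [|x _]; last by rewrite mulr_ge0.
move=> /allP gx; apply: big1 => x _.
by have := gx x; rewrite mem_index_enum => /(_ isT) /eqP ->; rewrite mul0r.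
Qed.

Let mean_ge0 g : (forall x, 0 <= g x) -> 0 <= \sum_x pi x * g x.
Proof. by move=> g0; rewrite sumr_ge0// => x _; rewrite mulr_ge0. Qed.

Lemma Ent_ge0 g : (forall x, 0 <= g x) -> 0 <= Ent pi g.
Proof.
move=> g0; have := mean_ge0 g0; rewrite le_eqVlt => /orP[/eqP/esym M0|M0].
  by rewrite Ent_null.
have gT : supported g [set: V]%SET by move=> x; rewrite inE.
by have := Ent_ge g0 gT M0; rewrite (mass_setT chain) divr1 ln1 mulr0.
Qed.

(** For a mean [M > 0] the two sides differ by [c - M - M * ln (c / M)], so [c] may be chosen freely
    at a nonnegative cost. *)
Lemma Ent_le g c : 0 < c -> (forall x, 0 <= g x) ->
  Ent pi g <= \sum_x pi x * entropy_term (g x) c.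
Proof.
move=> c0 g0; have := mean_ge0 g0; rewrite /Ent; set M := \sum_x pi x * g x.
have -> : \sum_x pi x * entropy_term (g x) c =
    \sum_x pi x * g x * ln (g x / c) - M + c.
  rewrite -[X in _ + X]mul1r -pi1 mulr_suml -sumrB -big_split.
  by apply: eq_bigr => x _; rewrite /entropy_term /=; ring.
rewrite le_eqVlt => /orP[/eqP M0|M0].
  have gx x : pi x * g x = 0.
    move/esym/eqP: M0; rewrite psumr_eq0 => [/allP/(_ x)|y _].
      by rewrite mem_index_enum => /(_ isT)/eqP.
    by rewrite mulr_ge0.
  rewrite -M0 subr0 !big1 ?add0r ?ltW// => x _; by rewrite gx mul0r.
have -> : \sum_x pi x * g x * ln (g x / M) =
    \sum_x pi x * g x * ln (g x / c) + M * ln (c / M).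
  rewrite mulr_suml -big_split; apply: eq_bigr => x _ /=.
  have := g0 x; rewrite le_eqVlt => /orP[/eqP <-|gx].
    by rewrite !(mulr0, mul0r) addr0.
  rewrite -mulrDr -lnM ?posrE ?divr_gt0//; congr (_ * ln _); field.
  by rewrite !gt_eqF.
have := @ln_le_subr1 R (c / M); rewrite divr_gt0// => /(_ isT).
move=> /(ler_wpM2l (ltW M0)); rewrite (_ : M * (c / M - 1) = c - M); last first.
  by field; rewrite gt_eqF.
lra.
Qed.

(** Take the largest value with at most half of the mass strictly below it. If more than half lay
    strictly above, the next value up would still qualify. *)
Lemma median_exists g : exists2 x0,
  mass pi [set z | (g z < g x0)%R]%SET <= 1 / 2 &
  mass pi [set z | (g x0 < g z)%R]%SET <= 1 / 2.
Proof.
have [z0 _] : exists z : V, true.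
  apply: contrapT => nV; have /eqP := pi1; rewrite big1 => [|z _].
    by rewrite eq_sym oner_eq0.
  by case: nV; exists z.
pose low x := mass pi [set z | (g z < g x)%R]%SET <= 1 / 2.
pose y0 := [arg min_(y < z0) g y]%O.
have lowy0 : low y0.
  rewrite /low; have -> : [set z | (g z < g y0)%R]%SET = finset.set0.
    apply/setP => z; rewrite !inE /y0; case: Order.TotalTheory.arg_minP => //= y _ ymin.
    by apply/negbTE; rewrite -leNgt ymin.
  by rewrite /mass big_set0; lra.
pose x0 := [arg max_(y > y0 | low y) g y]%O.
have [lx0 x0max] : low x0 /\ forall y, low y -> g y <= g x0.
  by rewrite /x0; case: Order.TotalTheory.arg_maxP.
exists x0 => //; rewrite leNgt; apply/negP => big.
pose T : {set V} := [set z | (g x0 < g z)%R]%SET.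
have /set0Pn[t0 tT] : T != finset.set0.
  by rewrite -(mass_gt0 chain); rewrite -/T in big; lra.
pose t := [arg min_(y < t0 in T) g y]%O.
have [tT' tmin] : t \in T /\ forall y, y \in T -> g t <= g y.
  by rewrite /t; case: Order.TotalTheory.arg_minP.
suff /x0max : low t by move: tT'; rewrite inE ltNge => /negbTE ->.
have : mass pi [set z | (g z < g t)%R]%SET <= mass pi (~: T)%SET.
  apply: (mass_le chain); apply/fintype.subsetP => z; rewrite [in X in X -> _]inE.
  by rewrite inE ltNge; apply: contra => /tmin.
have := mass_setC chain T.
by rewrite /low; move: big; rewrite -/T; lra.
Qed.

Lemma markov_level u x : (forall z, 0 <= u z) ->
  mass pi [set z | (u x <= 2 * u z)%R]%SET * u x ^+ 2 <= 4 * sqnorm pi u.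
Proof.
move=> u0; rewrite /mass /sqnorm mulr_suml mulr_sumr big_mkcond.
apply: ler_sum => z _; rewrite inE; case: ifPn => [h|_]; last first.
  by rewrite mulr_ge0// mulr_ge0 ?sqr_ge0.
rewrite [leRHS]mulrCA ler_wpM2l// (_ : 4 * _ = (2 * u z) ^+ 2); last by ring.
by rewrite lerXn2r ?nnegrE// mulr_ge0.
Qed.

Let level_log u x := ln (1 / mass pi [set z | (u x <= 2 * u z)%R]%SET).

Lemma level_log_ge u x : (forall z, 0 <= u z) ->
  mass pi [set z | (0 < u z)%R]%SET <= 1 / 2 -> 0 < u x ->
  2^-1 <= level_log u x /\ ln (4 * u x ^+ 2 / sqnorm pi u) <= 9 * level_log u x.
Proof.
move=> u0 uh ux; rewrite /level_log; set A := [set z | _]%SET.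
have A0 : 0 < mass pi A.
  by rewrite (mass_gt0 chain); apply/set0Pn; exists x; rewrite inE; lra.
have Ah : mass pi A <= 1 / 2.
  apply: le_trans uh; apply: (mass_le chain); apply/fintype.subsetP => z.
  by rewrite !inE; lra.
have L2 := ln_inv_ge_half A0 Ah; split => //.
have M := markov_level x u0; rewrite -/A in M.
have u2 : 0 < u x ^+ 2 by rewrite exprn_gt0.
have q0 : 0 < sqnorm pi u by have := mulr_gt0 A0 u2; lra.
(* By [markov_level] the argument is at most [16 / pi(A)]. Since [ln 16 <= 4] is at most 8 times
   [level_log], the total is 9. *)
have : ln (4 * u x ^+ 2 / sqnorm pi u) <= ln (2 ^+ 4 * (1 / mass pi A)).
  have m1 : 0 < 2 ^+ 4 * (1 / mass pi A) by rewrite mulr_gt0 ?exprn_gt0 ?divr_gt0.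
  rewrite ler_ln ?posrE// ?divr_gt0 ?mulr_gt0//.
  rewrite mul1r ler_pdivrMr// mulrAC ler_pdivlMr//.
  rewrite (_ : 2 ^+ 4 = 16); last by ring.
  lra.
have -> : ln (2 ^+ 4 * (1 / mass pi A)) = ln 2 * 4 + ln (1 / mass pi A).
  by rewrite lnM ?posrE ?divr_gt0 ?exprn_gt0// lnXn// -[ln 2 *+ 4]mulr_natr.
have := @ln_le_subr1 R 2; rewrite ltr0n => /(_ isT); lra.
Qed.

(** The increment of [f] is the difference of the increments of the two parts, which have opposite
    signs. *)
Lemma energy_split f mu :
  energy P pi (fun x => Num.max (f x - mu) 0) (fun x => Num.max (f x - mu) 0) +
  energy P pi (fun x => Num.max (mu - f x) 0) (fun x => Num.max (mu - f x) 0) <=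
  energy P pi f f.
Proof.
pose F (i : 'I_2) x := if i == ord0 then Num.max (f x - mu) 0 else Num.max (mu - f x) 0.
have := @ler_sum_energy R V P pi stP pi_gt0 2 F f.
rewrite big_ord_recl big_ord1; apply => x y; rewrite big_ord_recl big_ord1 /F /=.
rewrite /Num.max; do ?case: ifP => /=; nra.
Qed.

(** The entropy is compared with the constant [mu ^ 2 + q], where [mu] is a median of the modulus of
    [f] and [q] the squared norm of the part [u] above it. Both parts live on mass at most [1 / 2],
    where the logarithmic profile applies. *)
Lemma Ent_sqr_le (C m : R) f : 0 <= C -> 0 <= m ->
  profile C (1 / 2) (fun p => m * ln (1 / p)) ->
  (forall A g, A != finset.set0 -> mass pi A <= 1 / 2 -> supported g A ->
    m * ln (1 / mass pi A) * (\sum_x pi x * g x) ^+ 2 <=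
    mass pi A * energy P pi g g) ->
  m * Ent pi (fun x => f x ^+ 2) <= 48 * (13 * C * energy P pi f f).
Proof.
move=> C0 m0 prof cap; pose g x := `|f x|.
have g0 x : 0 <= g x by exact: normr_ge0.
have -> : (fun x => f x ^+ 2) = (fun x => g x ^+ 2).
  by apply/funext => x; rewrite real_normK ?num_real.
have [x0 low high] := median_exists g; set mu := g x0 in low high.
have mu0 : 0 <= mu by exact: g0.
pose u x := Num.max (g x - mu) 0; pose v x := Num.max (mu - g x) 0.
have u0 x : 0 <= u x by rewrite le_max lexx orbT.
have v0 x : 0 <= v x by rewrite le_max lexx orbT.
have uE x : (0 < u x) = (mu < g x) by rewrite lt_max ltxx orbF subr_gt0.
have vE x : (0 < v x) = (g x < mu) by rewrite lt_max ltxx orbF subr_gt0.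
have level w : (forall x, 0 <= w x) -> mass pi [set z | (0 < w z)%R]%SET <= 1 / 2 ->
    m * \sum_x pi x * (w x ^+ 2 * level_log w x) <= 13 * C * energy P pi w w.
  move=> w0 wh; apply: le_trans (profile_sum_le chain C0 prof w0 wh _).
    rewrite mulr_sumr le_eqVlt; apply/orP; left; apply/eqP.
    by apply: eq_bigr => x _; rewrite /level_log; ring.
  by move=> A h A0 Aw; apply: cap => //; apply: le_trans wh; exact: (mass_le chain).
have half w : (forall x, 0 <= w x) -> mass pi [set z | (0 < w z)%R]%SET <= 1 / 2 ->
    sqnorm pi w <= 2 * \sum_x pi x * (w x ^+ 2 * level_log w x).
  move=> w0 wh; rewrite mulr_sumr; apply: ler_sum => x _.
  rewrite [leRHS]mulrCA ler_wpM2l//; have := w0 x.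
  rewrite le_eqVlt => /orP[/eqP <-|wx]; first by rewrite expr0n /= mul0r mulr0.
  have [L2 _] := level_log_ge w0 wh wx; have := sqr_ge0 (w x); nra.
have uh : mass pi [set z | (0 < u z)%R]%SET <= 1 / 2.
  by rewrite (_ : [set z | _]%SET = [set z | (mu < g z)%R]%SET)//;
    apply/setP => z; rewrite !inE uE.
have vh : mass pi [set z | (0 < v z)%R]%SET <= 1 / 2.
  by rewrite (_ : [set z | _]%SET = [set z | (g z < mu)%R]%SET)//;
    apply/setP => z; rewrite !inE vE.
set q := sqnorm pi u; have q0 : 0 <= q by exact: sqnorm_ge0 chain _.
set Lu := \sum_x pi x * (u x ^+ 2 * level_log u x).
have u2L x : 0 <= u x ^+ 2 * level_log u x.
  have := u0 x; rewrite le_eqVlt => /orP[/eqP <-|ux]; first by rewrite expr0n mul0r.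
  have [L2 _] := level_log_ge u0 uh ux.
  by rewrite mulr_ge0 ?sqr_ge0//; lra.
(* Low values contribute [5 * (u ^ 2 + v ^ 2) + q] and high ones [4 * u ^ 2 * (9 * level_log) + q],
   hence the coefficients [5 + 1], [5] and [36]. *)
have Eg : Ent pi (fun x => g x ^+ 2) <= 6 * q + 5 * sqnorm pi v + 36 * Lu.
  have v20 : 0 <= sqnorm pi v by exact: sqnorm_ge0 chain _.
  have Lu0 : 0 <= Lu by apply: sumr_ge0 => x _; rewrite mulr_ge0.
  have [c0|c0] := ltP 0 (mu ^+ 2 + q); last first.
    have [mu00 q00] : mu ^+ 2 = 0 /\ q = 0 by have := sqr_ge0 mu; split; lra.
    rewrite Ent_null => [|x|]; [|exact: sqr_ge0|]; first by lra.
    have uz := sqnorm_eq0 chain q00; apply: big1 => x _.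
    move/eqP: mu00; rewrite sqrf_eq0 => /eqP mu00.
    by have := uz x; rewrite /u mu00 subr0 max_l// => ->; rewrite expr0n mulr0.
  apply: (le_trans (Ent_le c0 (fun x => sqr_ge0 (g x)))).
  have -> : 6 * q + 5 * sqnorm pi v + 36 * Lu = \sum_x pi x *
      (5 * u x ^+ 2 + 5 * v x ^+ 2 + q + 36 * (u x ^+ 2 * level_log u x)).
    transitivity (5 * q + 5 * sqnorm pi v + \sum_x pi x * q + 36 * Lu).
      by rewrite -mulr_suml pi1; ring.
    rewrite {1}/q /Lu /sqnorm !mulr_sumr -!big_split.
    by apply: eq_bigr => x _ /=; ring.
  apply: ler_sum => x _; rewrite ler_wpM2l//.
  have L0 := u2L x; have [g2|g2] := leP (g x) (2 * mu).
    apply: (le_trans (entropy_term_low (g0 x) q0 c0 g2)).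
    have -> : (g x - mu) ^+ 2 = u x ^+ 2 + v x ^+ 2; last by lra.
    by rewrite /u /v /Num.max; do ?case: ifP => /=; nra.
  have ux : 0 < u x by rewrite uE; lra.
  have ugx : u x = g x - mu by rewrite /u max_l//; lra.
  have [L2 Lq] := level_log_ge u0 uh ux.
  have q1 : 0 < q.
    rewrite /q /sqnorm (bigD1 x)//= ltr_pwDl ?mulr_gt0 ?exprn_gt0//.
    by apply: sumr_ge0 => y _; rewrite mulr_ge0 ?sqr_ge0.
  have L9 : 0 <= 9 * level_log u x by lra.
  rewrite ugx in Lq.
  apply: (le_trans (entropy_term_high mu0 q1 g2 L9 Lq)).
  by rewrite -ugx; have := sqr_ge0 (u x); have := sqr_ge0 (v x); lra.
have lu := level u u0 uh; have lv := level v v0 vh.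
have hu := half u u0 uh; have hv := half v v0 vh.
rewrite -/Lu in lu hu; rewrite -/q in hu.
set Lv := \sum_x pi x * (v x ^+ 2 * level_log v x) in lv hv.
have Esum : energy P pi u u + energy P pi v v <= energy P pi f f.
  exact: le_trans (energy_split g mu) (energy_abs stP pi_gt0 f).
(* Here [6 * q <= 12 * Lu] and [5 * sqnorm pi v <= 10 * Lv], by [half]. *)
have Em : m * Ent pi (fun x => g x ^+ 2) <= m * (48 * Lu + 10 * Lv).
  by rewrite ler_wpM2l//; lra.
have CE := ler_wpM2l C0 Esum.
have Ev := mulr_ge0 C0 (energy_ge0 stP pi_gt0 v).
apply: (le_trans Em); rewrite mulrDr; nra.
Qed.

End Entropy.

(** * Spectral profile, kappa and the log-Sobolev constant *)

(** The minimum over a finite nonempty family is attained, so [minimum] does not fall back on its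
    default 0. *)
Lemma minimum_image (R : realType) (I : finType) (D : set I) (F : I -> R) :
  D !=set0 -> is_min [set F i | i in D] (minimum [set F i | i in D]).
Proof.
move=> [i0 Di0]; apply: xgetPex; pose D' := [pred i | `[< D i >]].
have Di0' : D' i0 by exact/asboolP.
exists (F [arg min_(i < i0 | D' i) F i]%O).
case: Order.TotalTheory.arg_minP => // i /asboolP Di imin; split; first by exists i.
by move=> _ [j Dj <-]; apply: imin; exact/asboolP.
Qed.

Section Comparison.
Context {R : realType} {V : finType}.
Variables (P : V -> V -> R) (pi : V -> R).
Hypothesis chain : irreducible_reversible P pi.
Hypothesis V_gt1 : (1 < #|V|)%N.
Implicit Types (f g h u : V -> R) (A B S : {set V}) (delta : R).

Let stP : stochastic P. Proof. by case: chain. Qed.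
Let revP : reversible P pi. Proof. by case: chain. Qed.
Let pi_gt0 x : 0 < pi x. Proof. exact: stationary_gt0 chain x. Qed.

Lemma pi_star_min : is_min (range pi) (pi_star pi).
Proof.
apply: minimum_image; have /card_gt0P[x _] : (0 < #|V|)%N by exact: ltnW.
by exists x.
Qed.

Lemma pi_star_le x : pi_star pi <= pi x.
Proof. by have [_] := pi_star_min; apply; exists x. Qed.

Lemma pi_star_gt0 : 0 < pi_star pi.
Proof. by have [[x _ <-] _] := pi_star_min. Qed.

Lemma pi_star_le_half : pi_star pi <= 1 / 2.
Proof.
have [x [y xy]] : exists x y : V, x != y.
  have /card_gt1P[x [y [_ _ xy]]] := V_gt1; by exists x, y.
have [_ _ [_ pi1] _] := chain.
have : pi x + pi y <= 1.
  rewrite -pi1 (bigD1 x)//= lerD2l (bigD1 y) 1?eq_sym//= lerDl.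
  by apply: sumr_ge0 => z _; exact: ltW.
by have := pi_star_le x; have := pi_star_le y; lra.
Qed.

Lemma mass1 x : mass pi [set x]%SET = pi x.
Proof. by rewrite /mass big_set1. Qed.

Lemma pi_star_le_mass A : A != finset.set0 -> pi_star pi <= mass pi A.
Proof.
move=> /set0Pn[x xA]; apply: le_trans (pi_star_le x) _; rewrite -mass1.
by apply: (mass_le chain); rewrite finset.sub1set.
Qed.

Lemma irreducible1 x : irreducible_on P [set x]%SET.
Proof.
apply: (closed_irreducible (trans_ge0 chain)) => S; rewrite finset.subset1.
by move=> /orP[/eqP ->//|/eqP ->]; rewrite eqxx.
Qed.

Definition admissible delta B :=
  0 < mass pi B <= Num.min delta (1 - pi_star pi).

Lemma admissibleP delta B : admissible delta B ->
  [/\ B != finset.set0, B != [set: V]%SET & mass pi B <= delta].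
Proof.
rewrite /admissible le_min (mass_gt0 chain) => /and3P[B0 Bd Bp]; split => //.
by rewrite -(mass_lt1 chain) (le_lt_trans Bp)// gtrBl pi_star_gt0.
Qed.

Lemma admissible_subset delta A B : A \subset B -> A != finset.set0 ->
  admissible delta B -> admissible delta A.
Proof.
move=> AB A0 /andP[_ Bd]; rewrite /admissible (mass_gt0 chain) A0.
exact: le_trans (mass_le chain AB) Bd.
Qed.

Lemma admissible_half delta A : delta <= 1 / 2 -> A != finset.set0 ->
  mass pi A <= delta -> admissible delta A.
Proof.
move=> d2 A0 Ad; rewrite /admissible (mass_gt0 chain) A0 le_min Ad.
by have := pi_star_le_half; lra.
Qed.

Lemma admissible_exists delta : pi_star pi <= delta ->
  exists2 B, admissible delta B & irreducible_on P B.
Proof.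
move=> pd; have [[x _ px] _] := pi_star_min.
exists [set x]%SET; last exact: irreducible1.
rewrite /admissible mass1 pi_gt0 px le_min pd.
by have := pi_star_le_half; lra.
Qed.

Lemma Lambda_min delta : pi_star pi <= delta ->
  is_min [set lambda P B | B in [set B | admissible delta B]]
    (Lambda P pi delta).
Proof.
by move=> /admissible_exists[B Bd _]; apply: minimum_image; exists B.
Qed.

Section Kappa.
Variables (d : measure_display) (Omega : measurableType d).
Variables (Pr : (V -> R) -> probability Omega R) (X : nat -> Omega -> V).
Hypothesis XP : forall mu, distribution_on mu -> markov_chain P mu (Pr mu) X.

Lemma cond_distribution B : B != finset.set0 -> distribution_on (cond pi B).
Proof.
move=> B0; have m0 : 0 < mass pi B by rewrite (mass_gt0 chain).
split=> [x|]; first by rewrite mulr_ge0// divr_ge0 ?ltW.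
rewrite -[RHS](divff (lt0r_neq0 m0)) {1}/mass mulr_suml [RHS]big_mkcond.
by apply: eq_bigr => x _; rewrite /cond; case: ifP; rewrite ?mulr1 ?mulr0.
Qed.

(** The expectation is finite, so [fine] in [kappa] returns its true value. *)
Lemma mean_hitting_time_cond B : B != finset.set0 -> B != [set: V]%SET ->
  (\int[Pr (cond pi B)]_w hitting_time X (~: B)%SET w =
   (mean_exit P pi B)%:E)%E.
Proof.
move=> B0 BT; have hB := exit_funP chain BT.
have [c0 _] := cond_distribution B0.
rewrite (mean_hitting_time (XP (cond_distribution B0)) (trans_ge0 chain) hB c0).
  congr (_%:E); rewrite /mean_exit mulr_suml big_mkcond; apply: eq_bigr => x _.
  rewrite /cond; case: ifPn => [->|/hB.1 ->]; last by rewrite mulr0 mul0r.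
  by rewrite mulr1 mulrAC.
by move=> x; exact: (is_exit_ge0 chain x hB).
Qed.

Local Notation k := (kappa P pi Pr X).

Lemma kappa_min delta : pi_star pi <= delta ->
  is_min [set (mean_exit P pi B)^-1 |
    B in [set B | admissible delta B /\ irreducible_on P B]] (k delta).
Proof.
move=> pd; have -> : k delta = minimum [set (mean_exit P pi B)^-1 |
    B in [set B | admissible delta B /\ irreducible_on P B]].
  rewrite /kappa; congr minimum; apply: eq_imagel => B [/admissibleP[B0 BT _] _].
  by rewrite mean_hitting_time_cond.
have [B Bd Bi] := admissible_exists pd.
by apply: minimum_image; exists B.
Qed.

Lemma kappa_attained delta : pi_star pi <= delta ->
  exists B, [/\ admissible delta B, irreducible_on P B &
    k delta = (mean_exit P pi B)^-1].
Proof. by move=> /kappa_min[[B [Bd Bi] <-] _]; exists B. Qed.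

Lemma kappa_le delta A : pi_star pi <= delta -> admissible delta A ->
  k delta <= (mean_exit P pi A)^-1.
Proof.
move=> pd Ad; have [A0 AT _] := admissibleP Ad.
have [B [BA B0 Bi AB]] := irreducible_subset chain A0 AT.
have Bd := admissible_subset BA B0 Ad.
have [_ BT _] := admissibleP Bd.
apply: (@le_trans _ _ (mean_exit P pi B)^-1).
  by have [_] := kappa_min pd; apply; exists B.
by rewrite lef_pV2 ?posrE ?(mean_exit_gt0 chain).
Qed.

Lemma kappa_gt0 delta : pi_star pi <= delta -> 0 < k delta.
Proof.
move=> /kappa_attained[B [/admissibleP[B0 BT _] _ ->]].
by rewrite invr_gt0 (mean_exit_gt0 chain).
Qed.

Lemma kappa_capacity delta A g : pi_star pi <= delta -> admissible delta A ->
  supported g A ->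
  k delta * (\sum_x pi x * g x) ^+ 2 <= mass pi A * energy P pi g g.
Proof.
move=> pd Ad gA; have [A0 AT _] := admissibleP Ad.
apply: le_trans (mean_exit_capacity chain A0 AT gA).
by rewrite ler_wpM2r ?sqr_ge0// kappa_le.
Qed.

Lemma Lambda_le_kappa delta : pi_star pi <= delta ->
  Lambda P pi delta <= k delta.
Proof.
move=> pd; have [B [Bd Bi ->]] := kappa_attained pd.
have [B0 BT _] := admissibleP Bd.
apply: le_trans (lambda_mean_exit chain B0 BT).
by have [_] := Lambda_min pd; apply; exists B.
Qed.

Lemma kappa_le_Lambda C delta : 0 <= C -> (forall K, 0 <= K -> profile C 1 (fun=> K)) ->
  pi_star pi <= delta -> k delta <= 13 * C * Lambda P pi delta.
Proof.
move=> C0 prof pd; have [[B Bd <-] _] := Lambda_min pd.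
have [B0 BT _] := admissibleP Bd.
have [f [fB f0 fE]] := lambda_attained chain B0.
pose u x := `|f x|.
have u0 x : 0 <= u x by exact: normr_ge0.
have uB : [set x | (0 < u x)%R]%SET \subset B.
  apply/fintype.subsetP => x; rewrite inE; apply: contraTT => /fB fx.
  by rewrite /u fx normr0 ltxx.
have k0 : 0 <= k delta by exact/ltW/kappa_gt0.
have u1 : mass pi [set x | (0 < u x)%R]%SET <= 1.
  by rewrite -(mass_setT chain); apply: (mass_le chain); exact: finset.subsetT.
(* The profile is the constant [k delta]. All level sets of [u] lie in the optimal [B], hence are
   admissible at the same [delta]. *)
have := profile_sum_le chain C0 (prof _ k0) u0 u1.
have -> : \sum_x pi x * (u x ^+ 2 * k delta) = k delta * sqnorm pi f.
  rewrite mulr_sumr; apply: eq_bigr => x _; rewrite real_normK ?num_real//; ring.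
move=> H; rewrite -(ler_pM2r f0) -[13 * C * lambda P B * _]mulrA -fE.
apply: (le_trans (H _)); last first.
  by rewrite ler_wpM2l ?mulr_ge0// (energy_abs stP pi_gt0).
move=> A g A0 Au gA; apply: kappa_capacity => //.
by apply: admissible_subset Bd => //; exact: fintype.subset_trans uB.
Qed.

Lemma ln_inv_gt0 delta : 0 < delta -> delta <= 1 / 2 -> 0 < ln (1 / delta).
Proof. by move=> d0 d2; have := ln_inv_ge_half d0 d2; lra. Qed.

Lemma ln_inv_le (p q : R) : 0 < p -> p <= q -> ln (1 / q) <= ln (1 / p).
Proof.
move=> p0 pq; have q0 : 0 < q by exact: lt_le_trans pq.
by rewrite ler_ln ?posrE ?divr_gt0// !div1r lef_pV2 ?posrE.
Qed.

(** The minimum over a continuum of [delta] reduces to finitely many masses: if [B] attains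
    [k delta], replacing [delta] by [pi(B)] does not increase [k] and does not decrease the
    logarithm. *)
Lemma kappa_ratio_min : exists2 A,
  A != finset.set0 /\ mass pi A <= 1 / 2 &
  forall delta, pi_star pi <= delta <= 1 / 2 ->
    k (mass pi A) / ln (1 / mass pi A) <= k delta / ln (1 / delta).
Proof.
pose D : set {set V} := [set A | A != finset.set0 /\ mass pi A <= 1 / 2].
pose F A := k (mass pi A) / ln (1 / mass pi A).
have Dn : D !=set0.
  have [B Bd _] := admissible_exists pi_star_le_half.
  by exists B; have [B0 _ B2] := admissibleP Bd.
have [[A AD FA] Amin] := minimum_image F Dn.
exists A => // delta /andP[pd d2]; rewrite -/(F A) FA.
have [B [Bd Bi ->]] := kappa_attained pd; have [B0 BT mB] := admissibleP Bd.
have mB0 : 0 < mass pi B by rewrite (mass_gt0 chain).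
have mB2 : mass pi B <= 1 / 2 by exact: le_trans d2.
have d0 : 0 < delta by exact: lt_le_trans mB.
apply: (@le_trans _ _ (F B)); first by apply: Amin; exists B.
have pB := pi_star_le_mass B0.
apply: ler_pM; rewrite ?invr_ge0.
- exact/ltW/kappa_gt0.
- exact/ltW/ln_inv_gt0.
- by apply: kappa_le => //; exact: admissible_half.
- by rewrite lef_pV2 ?posrE ?ln_inv_gt0// ln_inv_le.
Qed.

Lemma dirichlet_ge0 f : 0 <= dirichlet P pi f.
Proof. by rewrite dirichlet_energy// energy_ge0. Qed.

Lemma c_LS_lbound : has_lbound [set dirichlet P pi f / Ent pi (fun x => f x ^+ 2)
    | f in [set f | Ent pi (fun x => f x ^+ 2) != 0]].
Proof.
exists 0 => _ [f _ <-]; rewrite divr_ge0 ?dirichlet_ge0// (Ent_ge0 chain)//.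
by move=> x; exact: sqr_ge0.
Qed.

Lemma Ent_exit_ge A : A != finset.set0 -> mass pi A <= 1 / 2 ->
  0 < sqnorm pi (exit_fun P A) * ln (1 / mass pi A) <=
  Ent pi (fun x => exit_fun P A x ^+ 2).
Proof.
move=> A0 A2; have mA : 0 < mass pi A by rewrite (mass_gt0 chain).
have AT : A != [set: V]%SET by rewrite -(mass_lt1 chain); lra.
have hA := exit_funP chain AT; set h := exit_fun P A in hA *.
have s0 := sum_exit_gt0 chain A0 hA.
have n0 : 0 < sqnorm pi h.
  have := sqr_mean_le chain hA.1.
  move/(lt_le_trans (exprn_gt0 2 s0)); rewrite pmulr_rgt0//.
rewrite mulr_gt0 ?ln_inv_gt0//=; apply: (Ent_ge chain) => //.
- by move=> x; exact: sqr_ge0.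
- by move=> x /hA.1 ->; rewrite expr0n.
Qed.

Lemma c_LS_nonempty : [set dirichlet P pi f / Ent pi (fun x => f x ^+ 2)
    | f in [set f | Ent pi (fun x => f x ^+ 2) != 0]] !=set0.
Proof.
have [B /admissibleP[B0 _ B2] _] := admissible_exists pi_star_le_half.
have /andP[nL0 EnL] := Ent_exit_ge B0 B2.
exists (dirichlet P pi (exit_fun P B) / Ent pi (fun x => exit_fun P B x ^+ 2)).
by exists (exit_fun P B) => //=; rewrite gt_eqF// (lt_le_trans nL0).
Qed.

(** For the exit function [h] with sum [s], the energy is [s], the entropy is at least
    [sqnorm pi h * L], and [s ^ 2 <= pi(A) * sqnorm pi h]. *)
Lemma c_LS_le A : A != finset.set0 -> mass pi A <= 1 / 2 ->
  c_LS P pi <= (mean_exit P pi A)^-1 / ln (1 / mass pi A).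
Proof.
move=> A0 A2; have mA : 0 < mass pi A by rewrite (mass_gt0 chain).
have AT : A != [set: V]%SET by rewrite -(mass_lt1 chain); lra.
have hA := exit_funP chain AT.
have /andP[nL0 EnL] := Ent_exit_ge A0 A2; set h := exit_fun P A in hA nL0 EnL *.
have E0 : 0 < Ent pi (fun x => h x ^+ 2) by exact: lt_le_trans EnL.
have L0 := ln_inv_gt0 mA A2; set L := ln _ in nL0 EnL L0 *.
have s0 := sum_exit_gt0 chain A0 hA.
apply: (@le_trans _ _ (dirichlet P pi h / Ent pi (fun x => h x ^+ 2))).
  by apply: (ge_inf c_LS_lbound); exists h => //=; rewrite gt_eqF.
rewrite dirichlet_energy// (is_exit_energy chain hA hA.1).
rewrite /mean_exit -/h invf_div; set s := \sum_x _ in s0 *.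
have sn := sqr_mean_le chain hA.1; rewrite -/s in sn.
rewrite ler_pdivrMr// mulrAC ler_pdivlMr// mulrAC ler_pdivlMr//.
have := ler_wpM2l (ltW mA) EnL; have := ler_wpM2r (ltW L0) sn; lra.
Qed.

Lemma c_LS_ge0 : 0 <= c_LS P pi.
Proof.
apply: lb_le_inf c_LS_nonempty _ => _ [f _ <-]; rewrite divr_ge0 ?dirichlet_ge0// (Ent_ge0 chain)//.
by move=> x; exact: sqr_ge0.
Qed.

Lemma c_LS_le_kappa delta : pi_star pi <= delta <= 1 / 2 ->
  c_LS P pi <= k delta / ln (1 / delta).
Proof.
move=> /andP[pd d2]; have [B [Bd _ ->]] := kappa_attained pd.
have [B0 BT mB] := admissibleP Bd.
have mB0 : 0 < mass pi B by rewrite (mass_gt0 chain).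
have mB2 : mass pi B <= 1 / 2 by exact: le_trans d2.
apply: (le_trans (c_LS_le B0 mB2)).
rewrite ler_wpM2l ?invr_ge0 ?(ltW (mean_exit_gt0 chain _ _))//.
have d0 : 0 < delta by exact: lt_le_trans mB.
by rewrite lef_pV2 ?posrE ?ln_inv_gt0// ln_inv_le.
Qed.

(** At [delta = pi(A)] the bound on [m] reads [m * ln (1 / pi(A)) <= k (pi(A))], which supplies the
    capacity hypothesis of [Ent_sqr_le]. *)
Lemma kappa_le_c_LS C m : 0 < C ->
  (forall m, 0 <= m -> profile C (1 / 2) (fun p => m * ln (1 / p))) ->
  0 <= m ->
  (forall delta, pi_star pi <= delta <= 1 / 2 -> m <= k delta / ln (1 / delta)) ->
  m <= 48 * (13 * C) * c_LS P pi.
Proof.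
move=> C0 prof m0 mk.
rewrite mulrC -ler_pdivrMr ?mulr_gt0//.
apply: lb_le_inf c_LS_nonempty _ => _ [f /= f0 <-].
have E0 : 0 < Ent pi (fun x => f x ^+ 2).
  by rewrite lt_neqAle eq_sym f0 (Ent_ge0 chain)// => x; exact: sqr_ge0.
rewrite ler_pdivrMr ?mulr_gt0// mulrAC ler_pdivlMr// mulrC.
rewrite mulrC dirichlet_energy// [leRHS]mulrC -mulrA.
apply: (Ent_sqr_le chain) => //; [exact: ltW|exact: prof|].
move=> A g A0 A2 gA; have mA : 0 < mass pi A by rewrite (mass_gt0 chain).
have pA := pi_star_le_mass A0.
apply: le_trans (kappa_capacity pA (admissible_half A2 A0 (lexx _)) gA).
rewrite ler_wpM2r ?sqr_ge0// -ler_pdivlMr ?ln_inv_gt0//.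
by apply: mk; rewrite pA.
Qed.

End Kappa.

End Comparison.

Theorem corollary1p3 (R : realType) :
  exists c2 : R, 0 < c2 /\
  forall (V : finType) (P : V -> V -> R) (pi : V -> R)
    (d : measure_display) (Omega : measurableType d)
    (Pr : (V -> R) -> probability Omega R) (X : nat -> Omega -> V),
  (1 < #|V|)%N ->
  irreducible_reversible P pi ->
  (forall mu : V -> R, distribution_on mu -> markov_chain P mu (Pr mu) X) ->
  (forall delta : R, pi_star pi <= delta <= 1 ->
     Lambda P pi delta <= kappa P pi Pr X delta /\
     kappa P pi Pr X delta <= c2^-1 * Lambda P pi delta) /\
  (exists m : R,
     is_min [set kappa P pi Pr X delta / ln (1 / delta)
              | delta in [set delta | pi_star pi <= delta <= 1 / 2]] m /\
     c_LS P pi / 17 <= m /\ m <= c_LS P pi / c2).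
Proof.
have := @profile_log R; have := @profile_cst R.
have : 0 < 1728 :> R by rewrite ltr0n.
set C : R := 1728; move: C => C C0 profc profl.
have K0 : 0 < 48 * (13 * C) by rewrite !mulr_gt0.
(* The factor [13 * C] suffices against [Lambda]; the extra 48 comes from [Ent_sqr_le]. *)
exists (48 * (13 * C))^-1; split; first by rewrite invr_gt0.
move=> V P pi d Omega Pr X V1 chain XP; split.
  move=> delta /andP[pd _]; split; first exact: (Lambda_le_kappa chain V1 XP).
  have h := kappa_le_Lambda chain V1 XP (ltW C0) profc pd.
  apply: (le_trans h); rewrite invrK.
  have k0 := kappa_gt0 chain V1 XP pd.
  (* Positivity of [kappa] and the bound [h] make [Lambda] nonnegative, which permits the extra
     factor 48. *)
  have : 0 <= C * Lambda P pi delta by lra.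
  by lra.
have [A [A0 A2] Amin] := kappa_ratio_min chain V1 XP.
have pA := pi_star_le_mass chain V1 A0.
have mA : 0 < mass pi A by rewrite (mass_gt0 chain).
exists (kappa P pi Pr X (mass pi A) / ln (1 / mass pi A)); split.
  split; first by exists (mass pi A) => //=; rewrite pA.
  by move=> _ [delta dd <-]; exact: Amin.
split.
  (* The comparison holds with constant 1, and [c_LS] is nonnegative. *)
  have := c_LS_le_kappa chain V1 XP (delta := mass pi A).
  by rewrite pA A2 => /(_ isT); have := c_LS_ge0 chain V1; lra.
rewrite invrK [leRHS]mulrC; apply: (kappa_le_c_LS chain V1 XP C0) => //.
by rewrite divr_ge0 ?(ltW (kappa_gt0 chain V1 XP _)) ?(ltW (ln_inv_gt0 _ _)).
Qed.
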